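(* Let $W$ be a finite-dimensional complex vector space and let $n>m$ be positive integers. If $4m<n$, then the variety of padded polynomials $F_{n-m}(S^nW^* )$ is cut out set-theoretically by equations of degree two. For any $n>m$, $$I_2(F_{n-m}(S^nW^* ))=\bigoplus_{k=1}^{\lfloor n/2\rfloor-m} S_{(2(n-m-k),\,2(m+k))}W .$$
   Context: $S^d(S^nW)$ is regarded as the space of homogeneous polynomials of degree $d$ on $S^nW^*$; for a cone $X\subset S^nW^*$, $I_d(X)\subset S^d(S^nW)$ is the space of degree $d$ polynomials vanishing on $X$. The variety of padded polynomials is $$F_{n-m}(S^nW^* ):=\{P\in S^nW^*\mid P=\ell^{n-m}h \text{ for some } \ell\in W^*,\ h\in S^mW^*\}.$$ $S_\pi W$ denotes the irreducible $GL(W)$-module associated to the partition $\pi$ (zero if $\pi$ has more than $\dim W$ parts). In the displayed formula, each $S_{(2(n-m-k),2(m+k))}W$ denotes the unique copy of that module in the multiplicity-free $GL(W)$-module $S^2(S^nW)=\bigoplus_{s=0}^{\lfloor n/2\rfloor}S_{(2n-2s,2s)}W$. An empty direct sum is zero. *)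

(* Defs.v *)
From HB Require Import structures.
From mathcomp Require Import all_boot all_order all_algebra.
From mathcomp Require Import complex.
From mathcomp Require Import mpoly.
From mathcomp Require Import reals.

Set Implicit Arguments.
Unset Strict Implicit.
Unset Printing Implicit Defensive.

Import GRing.Theory.
Local Open Scope ring_scope.

(* Homogeneous polynomials of degree d on a finite-dimensional space V, i.e.
   S^d V^*, written in the coordinates given by [vbasis {:V}].  Thus S^n W^* is
   [hpoly n W] and S^d (S^n W) is [hpoly d (hpoly n W)]. *)
Definition hpoly (F : fieldType) (d : nat) (V : vectType F) : Type :=
  dhomog (\dim {:V}) F d.

(* The library instance only covers a nonzero number of variables; for the zero
   space, S^0 is the constants and S^d is zero for d > 0. *)
Lemma dhomog_vector_axiom (F : fieldType) (d n : nat) :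
  Vector.axiom 'C((d + n).-1, d) (dhomog n F d).
Proof.
case: n => [|n]; last by rewrite addnS; exact: dhomog_vecaxiom.
have mP (m : 'X_{1..0}) : m = 0%MM by apply/mnmP; case.
case: d => [|d]; rewrite addn0.
  have h1 (v : 'rV[F]_1) : v 0 0 *: (1 : {mpoly F[0]}) \is 0.-homog.
    exact/dhomogZ/dhomog1.
  exists (fun p : dhomog 0 F 0 => \row__ (p : {mpoly F[0]})@_0%MM : 'rV_1) => [a p q|].
    by apply/rowP => i; rewrite !mxE mcoeffD mcoeffZ.
  exists (fun v => DHomog (h1 v)) => [p|v].
    apply/val_inj/mpolyP => m /=.
    by rewrite mxE (mP m) mcoeffZ mcoeff1 eqxx mulr1.
  by apply/rowP => i; rewrite mxE /= mcoeffZ mcoeff1 eqxx mulr1 ord1.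
rewrite bin_small //; exists (fun=> 0) => [a u v|].
  by rewrite scaler0 addr0.
exists (fun=> 0) => [p|v]; last by apply/rowP; case.
apply/val_inj/mpolyP => m /=; rewrite mcoeff0.
rewrite (@dhomog_nemf_coeff _ _ mdeg d.+1) ?dhomog_is_dhomog //.
by rewrite (mP m) mf0.
Qed.

HB.instance Definition _ (F : fieldType) d (V : vectType F) :=
  GRing.Lmodule.copy (hpoly d V) (dhomog (\dim {:V}) F d).
HB.instance Definition _ (F : fieldType) d (V : vectType F) :=
  Lmodule_hasFinDim.Build F (hpoly d V) (dhomog_vector_axiom F d (\dim {:V})).

Definition heval (F : fieldType) d (V : vectType F) (p : hpoly d V) (v : V) : F :=
  (p : {mpoly F[_]}).@[fun i => coord (vbasis {:V}) i v].

Section Pullback.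
Variables (F : fieldType) (V1 V2 : vectType F).
Implicit Types (g : 'Hom(V1, V2)) (d : nat).

Definition lin_coords g : (\dim {:V2}).-tuple {mpoly F[\dim {:V1}]} :=
  [tuple \sum_(j < \dim {:V1})
     coord (vbasis {:V2}) i (g (vbasis {:V1})`_j) *: 'X_j | i < \dim {:V2}].

Lemma pullback_homog g d (p : hpoly d V2) :
  (p : {mpoly F[_]}) \mPo lin_coords g \is d.-homog.
Proof.
rewrite comp_mpolyE big_seq rpred_sum // => m mp; apply/rpredZ.
have <- : mdeg m = d by exact: (dhomog_mf (dhomog_is_dhomog p) mp).
rewrite mdegE; elim/big_rec2: _ => [|i e q _ hq]; first exact: dhomog1.
apply: dhomogM => //; rewrite -[X in X.-homog]mul1n; apply: dhomogMn.
rewrite tnth_mktuple rpred_sum // => j _; apply/rpredZ.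
by rewrite dhomogX; apply/eqP; exact: mdeg1.
Qed.

Definition pullback d g (p : hpoly d V2) : hpoly d V1 :=
  DHomog (pullback_homog g p).

Lemma pullback_is_linear d g : linear (@pullback d g).
Proof. by move=> a p q; apply: val_inj; rewrite /= linearP. Qed.

HB.instance Definition _ d g :=
  GRing.isLinear.Build F (hpoly d V2) (hpoly d V1) _ (@pullback d g)
    (@pullback_is_linear d g).

Lemma heval_pullback d g (p : hpoly d V2) v :
  heval (pullback g p) v = heval p (g v).
Proof.
rewrite /heval comp_mpoly_meval; apply: meval_eq => i.
rewrite tnth_mktuple {2}(coord_vbasis (memvf v)) !linear_sum /=.
apply: eq_bigr => j _.
by rewrite !linearZ /= mevalXU mulrC.
Qed.

End Pullback.

(* The action of g in GL(W) on S^d (S^n W), viewed as degree d polynomials on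
   S^n W^*: (g q)(P) = q(P o g). *)
Definition sym_act (F : fieldType) (W : vectType F) d n (g : 'End(W)) :
    'End(hpoly d (hpoly n W)) :=
  linfun (@pullback F (hpoly n W) (hpoly n W) d (linfun (@pullback F W W n g))).

Lemma heval_sym_act (F : fieldType) (W : vectType F) d n (g : 'End(W))
    (q : hpoly d (hpoly n W)) (P : hpoly n W) :
  heval (sym_act d n g q) P = heval q (pullback g P).
Proof. by rewrite lfunE /= heval_pullback lfunE. Qed.

Section GLModules.
Variables (F : fieldType) (W M : vectType F) (rho : 'End(W) -> 'End(M)).

Definition invertible_end (g : 'End(W)) : bool := lker g == 0%VS.

Definition GL_stable (U : {vspace M}) : Prop :=
  forall g, invertible_end g -> (rho g @: U <= U)%VS.

Definition GL_irreducible (U : {vspace M}) : Prop :=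
  [/\ GL_stable U, U != 0%VS &
      forall U' : {vspace M}, GL_stable U' -> (U' <= U)%VS ->
        U' = 0%VS \/ U' = U].

Definition end_coef (g : 'End(W)) (i j : 'I_(\dim {:W})) : F :=
  coord (vbasis {:W}) i (g (vbasis {:W})`_j).

(* The Borel subgroup stabilizing the flag spanned by the initial segments of
   [vbasis {:W}]. *)
Definition upper_triangular (g : 'End(W)) : Prop :=
  forall i j : 'I_(\dim {:W}), (j < i)%N -> end_coef g i j = 0.

(* Common eigenvector of the Borel subgroup: the unipotent part acts trivially and
   diag(t_0, t_1, ...) by the product of the t_i ^+ pi_i. *)
Definition highest_weight_vector (pi : seq nat) (v : M) : Prop :=
  v != 0 /\
  forall g, invertible_end g -> upper_triangular g ->
    rho g v = (\prod_(i < \dim {:W}) end_coef g i i ^+ nth 0%N pi i) *: v.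

(* U is a copy in M of the module S_pi W: the irreducible GL(W)-module of highest
   weight pi if pi has at most dim W (nonzero) parts, and zero otherwise. *)
Definition is_schur_module (pi : seq nat) (U : {vspace M}) : Prop :=
  if (count (leq 1) pi <= \dim {:W})%N then
    GL_irreducible U /\ exists2 v, v \in U & highest_weight_vector pi v
  else U = 0%VS.

End GLModules.

(* I_d(X). *)
Definition vanishing_forms (F : fieldType) (V : vectType F) d (X : V -> Prop)
    (q : hpoly d V) : Prop :=
  forall v, X v -> heval q v = 0.

Definition cut_out_in_degree (F : fieldType) (V : vectType F) d (X : V -> Prop) :
    Prop :=
  exists E : hpoly d V -> Prop,
    forall v, X v <-> (forall q, E q -> heval q v = 0).

(* The variety F_(n-m) inside S^n W^*: polynomials l^(n-m) h. *)
Definition padded (F : fieldType) (W : vectType F) (n m : nat) (P : hpoly n W) :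
    Prop :=
  exists (l : hpoly 1 W) (h : hpoly m W),
    (P : {mpoly F[_]}) = (l : {mpoly F[_]}) ^+ (n - m) * (h : {mpoly F[_]}).

(* Main.v *)
(* Quadrics on S^n W^* are symmetric tensors in S^n W (x) S^n W.  The module of
   highest weight (2n-2s, 2s) is spanned by the quadrics P |-> (P, P)_(2s), the
   transvectants of order 2s along pairs (e, w) of vectors of W.

   Quadratic part of the ideal.  The form <q, q'> = sum_(I, J) q_(I, J) conj(q'_(I, J)),
   with q_(I, J) the polarization of q at the monomials of the words I and J, is
   contravariant, so stable subspaces have stable complements.  Orthogonality of
   q to all transvectants of order 2s says that
     sum_i (-1)^i C(2s, i) b_(i, 2s-i) = 0
   for all linear forms l and mu, where b_(i, j) is the polarization of q at
   (l^(n-i) mu^i, l^(n-j) mu^j).  If q vanishes on all l^(n-m) h then b_(i, j) = 0 for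
   i, j <= m.  Replacing l by l + t mu shows that once all b_(i, j) with i + j = k - 1
   vanish, those with i + j = k are alternating positive multiples of b_(0, k); hence
   they all vanish if k is odd (by symmetry), if k = 2s with s <= m, or if q is
   orthogonal to the transvectants of order 2s.  So a q in the ideal that is orthogonal
   to all transvectants of order > 2m is zero, and transvectants of distinct orders
   are orthogonal.

   Equations.  Let all transvectants of P of order M = 2m + 1 vanish, and P(e) != 0.
   For w in W let L be the functional x^i |-> D_e^(n-i) D_w^i P.  By a dimension count
   there is a form g of degree r <= n/2 + 1 with L(g f) = 0 for all f; take r minimal.
   Two distinct roots a, b of g would give (a - b)^M = 0 when the vanishing
   transvectant is applied to g/(x - a) and g/(x - b); the degrees allow this
   because 4m < n.  So g is a power of some x - a, then r <= m + 1, and u = w - a e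
   satisfies D_u^(m+1) P = 0.  The u with this property form a linear subspace:
   the kernel of a linear form whose (n-m)-th power divides P. *)
Require Import Defs.
From HB Require Import structures.
From mathcomp Require Import all_boot all_order all_algebra.
From mathcomp Require Import complex mpoly reals boolp.
From mathcomp Require Import zify ring.

Set Implicit Arguments.
Unset Strict Implicit.
Unset Printing Implicit Defensive.

Import GRing.Theory Num.Theory.
Local Open Scope ring_scope.

(** * Transvectants of commuting operators *)

Section Transvectant.
Variables (F : comNzRingType) (E : lmodType F).

(* (X (x) Y - Y (x) X)^M applied to p (x) q, evaluated at phi (x) psi. *)
Fixpoint transv (X Y : E -> E) M (phi psi : E -> F) (p q : E) : F :=
  if M is M'.+1 then
    transv X Y M' (phi \o X) (psi \o Y) p q -
    transv X Y M' (phi \o Y) (psi \o X) p q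
  else phi p * psi q.

Lemma eq_transv X X' Y Y' M phi phi' psi psi' p q :
  X =1 X' -> Y =1 Y' -> phi =1 phi' -> psi =1 psi' ->
  transv X Y M phi psi p q = transv X' Y' M phi' psi' p q.
Proof.
move=> eX eY; elim: M phi phi' psi psi' => [|M IH] phi phi' psi psi' e1 e2 /=.
  by rewrite e1 e2.
by congr (_ - _); apply: IH => x /=; rewrite ?eX ?eY ?e1 ?e2.
Qed.

Lemma transvDl X Y M c phi phi' psi p q :
  transv X Y M (fun x => phi x + c * phi' x) psi p q =
  transv X Y M phi psi p q + c * transv X Y M phi' psi p q.
Proof.
elim: M phi phi' psi => [|M IH] phi phi' psi /=; first by rewrite mulrDl mulrA.
by rewrite !IH mulrBr; ring.
Qed.

Lemma transvDr X Y M c phi psi psi' p q :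
  transv X Y M phi (fun x => psi x + c * psi' x) p q =
  transv X Y M phi psi p q + c * transv X Y M phi psi' p q.
Proof.
elim: M phi psi psi' => [|M IH] phi psi psi' /=; first by rewrite mulrDr mulrCA.
by rewrite !IH mulrBr; ring.
Qed.

(** Replacing Y by Y + cX adds c (X (x) X - X (x) X) = 0 to X (x) Y - Y (x) X. *)
Lemma transv_shear X Y M c (phi psi : E -> F) p q :
    scalar phi -> scalar psi -> linear X -> linear Y ->
  transv X (fun x => Y x + c *: X x) M phi psi p q = transv X Y M phi psi p q.
Proof.
move=> + + linX linY.
have linXY : linear (fun x => Y x + c *: X x).
  by move=> a x y; rewrite linX linY !scalerDr !scalerA (mulrC c a) addrACA.
have scomp (f : E -> F) (Z : E -> E) : scalar f -> linear Z -> scalar (f \o Z).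
  by move=> sf lZ a x y /=; rewrite lZ sf.
have sdist (f : E -> F) : scalar f ->
    (f \o (fun x => Y x + c *: X x)) =1 (fun x => (f \o Y) x + c * (f \o X) x).
  by move=> sf x /=; rewrite addrC sf addrC.
elim: M phi psi => [//|M IH] phi psi sphi spsi /=.
rewrite !IH; try exact: scomp.
rewrite (eq_transv (psi' := fun x => (psi \o Y) x + c * (psi \o X) x)
           (phi' := phi \o X) M p q (frefl X) (frefl Y) (frefl _) (sdist _ spsi)).
rewrite (eq_transv (phi' := fun x => (phi \o Y) x + c * (phi \o X) x)
           (psi' := psi \o X) M p q (frefl X) (frefl Y) (sdist _ sphi) (frefl _)).
by rewrite transvDl transvDr; ring.
Qed.

Lemma iter_comm (X Y : E -> E) i j : (forall x, X (Y x) = Y (X x)) ->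
  forall x, iter i X (iter j Y x) = iter j Y (iter i X x).
Proof.
move=> XY; elim: i => // i IH x; rewrite !iterS IH.
by elim: j {IH} => //= j <-; rewrite XY.
Qed.

(** Binomial expansion of a power of X (x) Y - Y (x) X, whose two terms commute because X and Y do;
    the induction is Pascal's rule. *)
Lemma transvE X Y M phi psi p q : (forall x, X (Y x) = Y (X x)) ->
  transv X Y M phi psi p q =
  \sum_(i < M.+1) (-1) ^+ i * 'C(M, i)%:R *
    phi (iter (M - i) X (iter i Y p)) * psi (iter i X (iter (M - i) Y q)).
Proof.
move=> XY; elim: M phi psi => [|M IH] phi psi /=.
  by rewrite big_ord1 /= ?subnn expr0 bin0 !mul1r.
rewrite !IH.
have XYi k x : iter k Y (X x) = X (iter k Y x) by elim: k => //= k ->; rewrite XY.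
have YXi k x : iter k X (Y x) = Y (iter k X x) by elim: k => //= k ->; rewrite XY.
rewrite [RHS]big_ord_recl /= ?subn0 expr0 bin0 !mul1r.
rewrite [X in _ = _ + X](eq_bigr (fun i : 'I_M.+1 => (-1) ^+ i.+1 * 'C(M, i.+1)%:R *
    phi (iter (M - i) X (iter i.+1 Y p)) *
    psi (iter i.+1 X (iter (M - i) Y q)) - (-1) ^+ i * 'C(M, i)%:R *
    phi (iter (M - i) X (iter i.+1 Y p)) *
    psi (iter i.+1 X (iter (M - i) Y q)))); last first.
  move=> i _; rewrite /bump /= ?add1n ?subSS binS natrD exprS; ring.
rewrite sumrB addrA; congr (_ - _); last first.
  apply: eq_bigr => i _; rewrite /comp /= -!iterS.
  by rewrite [iter i.+1 Y p]iterS YXi.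
rewrite [in RHS]big_ord_recr /= bin_small // mulr0 !mul0r addr0.
rewrite big_ord_recl /= ?subn0 expr0 bin0 !mul1r; congr (_ + _).
apply: eq_bigr => i _; rewrite /bump /= ?add1n.
have -> : (M - i = (M - i.+1).+1)%N by have := ltn_ord i; lia.
by rewrite add0n [iter _.+1 Y q]iterS; congr (_ * psi _); rewrite YXi XY.
Qed.

End Transvectant.

(** * Annihilators of binary forms *)

Section BinaryForms.
Variables (F : numClosedFieldType) (L : {poly F} -> F) (n m : nat).
Hypotheses (L_scalar : scalar L) (L1 : L 1 != 0) (lt4mn : (4 * m < n)%N).

Let M := m.*2.+1.
Let mulX (f : {poly F}) := f * 'X.
(** [L] acts on dehomogenized binary forms of degree n; [id] and [mulX] are multiplication by the
    two variables. In two variables: L (x) L kills (y - x)^M f(x) h(y). *)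
Hypothesis L_transv : forall f h : {poly F},
  (size f <= (n - M).+1)%N -> (size h <= (n - M).+1)%N ->
  transv id mulX M L L f h = 0.

HB.instance Definition _ := GRing.isLinear.Build F {poly F} F _ L L_scalar.

Lemma iter_rmul (a f : {poly F}) i : iter i (fun f => f * a) f = f * a ^+ i.
Proof. by elim: i => [|i /= ->]; rewrite ?mulr1 // exprSr mulrA. Qed.

(** The shear with c = -a is the translation y - x = (y - a) - (x - a). *)
Lemma transv_polyE a (f h : {poly F}) :
    (size f <= (n - M).+1)%N -> (size h <= (n - M).+1)%N ->
  \sum_(i < M.+1) (-1) ^+ i * 'C(M, i)%:R * L (f * ('X - a%:P) ^+ i) *
     L (h * ('X - a%:P) ^+ (M - i)) = 0.
Proof.
move=> sf sh; have := L_transv sf sh; rewrite -(@transv_shear _ _ id mulX M (- a)) //; last first.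
  by move=> c x y; rewrite /mulX mulrDl scalerAl.
have -> : (fun x : {poly F} => mulX x + - a *: id x) = (fun f => f * ('X - a%:P)).
  by apply: funext => p; rewrite /mulX mulrBr scaleNr (mulrC p a%:P) mul_polyC.
rewrite transvE // => {2}<-; apply: eq_bigr => i _.
have iter_id k (x : {poly F}) : iter k id x = x by elim: k.
by rewrite !iter_id !iter_rmul.
Qed.

(** Apolarity: g stands for a binary form of degree r, so a size below r + 1 means a root at
    infinity. *)
Definition annihilates r (g : {poly F}) :=
  [/\ g != 0, (size g <= r.+1)%N &
      forall f : {poly F}, (size f <= (n - r).+1)%N -> L (g * f) = 0].

(** f - f(a) is divisible by x - a, and L kills g (x - a) times the quotient. When L g = 0 this
    makes g an annihilator of degree r - 1. *)
Lemma annihilator_root r g a (f : {poly F}) : (r <= n)%N ->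
    annihilates r (g * ('X - a%:P)) -> (size f <= (n - r).+2)%N ->
  L (g * f) = f.[a] * L g.
Proof.
move=> len [g0 sg Lg] sf.
have /factor_theorem [f1 ef] : root (f - f.[a]%:P) a.
  by rewrite /root hornerD hornerN hornerC subrr.
have {1}-> : f = f.[a]%:P + f1 * ('X - a%:P) by rewrite -ef addrC subrK.
have sf1 : (size f1 <= (n - r).+1)%N.
  have [->|f10] := eqVneq f1 0; first by rewrite size_poly0.
  have : (size (f1 * ('X - a%:P))%R <= (n - r).+2)%N.
    rewrite -ef (leq_trans (size_polyD _ _)) // geq_max sf size_polyN.
    exact: leq_trans (size_polyC_leq1 _) _.
  by rewrite size_Mmonic ?monicXsubC // size_XsubC addn2.
rewrite mulrDr linearD /= (mulrC f1) mulrA Lg // addr0.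
by rewrite mulrC mul_polyC linearZ.
Qed.

(** The analogue for a root at infinity: the top coefficient replaces the value at a. *)
Lemma annihilator_lead r g (f : {poly F}) : (0 < r <= n)%N ->
    annihilates r g -> (size f <= (n - r).+2)%N ->
  L (g * f) = f`_(n - r).+1 * L (g * 'X^((n - r).+1)).
Proof.
move=> len [g0 sg Lg] sf.
have {1}-> : f = (f - f`_(n - r).+1 *: 'X^((n - r).+1)) +
   f`_(n - r).+1 *: 'X^((n - r).+1) by rewrite subrK.
rewrite mulrDr linearD /= Lg; first by rewrite add0r -scalerAr linearZ.
apply/leq_sizeP => j; rewrite leq_eqVlt => /orP[/eqP<-|ltj].
  by rewrite coefB coefZ coefXn eqxx mulr1 subrr.
rewrite coefB coefZ coefXn gtn_eqF // mulr0 subr0.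
exact: (leq_sizeP _ _ sf).
Qed.

Lemma size_divXsubC r (g : {poly F}) a :
  annihilates r (g * ('X - a%:P)) -> g != 0 /\ (size g <= r)%N.
Proof.
case=> g0 sg _; have gn0 : g != 0 by apply: contraNneq g0 => ->; rewrite mul0r.
by split=> //; move: sg; rewrite size_Mmonic ?monicXsubC // size_XsubC addn2.
Qed.

(** Take f = (x - a)^(r-m-1) and h = (x - a)^(r-m). The two exponents in each term add up to 2r, so
    every term but i = m + 1 contains a power above r; that one is a nonzero multiple of L((x -
    a)^r)^2. *)
Lemma top_power_eq0 a r : (m < r <= n./2)%N ->
    (forall j, (r < j <= n)%N -> L (('X - a%:P) ^+ j) = 0) ->
  L (('X - a%:P) ^+ r) = 0.
Proof.
move=> /andP[ltmr ler] Lbig.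
have eM : M = m.*2.+1 by [].
have s1 : (size (('X - a%:P) ^+ (r - m.+1))%R <= (n - M).+1)%N.
  by rewrite size_exp_XsubC /M; lia.
have s2 : (size (('X - a%:P) ^+ (r - m))%R <= (n - M).+1)%N.
  by rewrite size_exp_XsubC /M; lia.
have := transv_polyE a s1 s2.
have ltM : (m.+1 < M.+1)%N by rewrite /M; lia.
rewrite (bigD1 (Ordinal ltM)) //= [X in _ + X]big1 => [|i nei].
  rewrite addr0 -!exprD.
  have -> : (r - m.+1 + m.+1 = r)%N by lia.
  have -> : (r - m + (M - m.+1) = r)%N by rewrite /M; lia.
  move/eqP; rewrite !mulf_eq0 signr_eq0 pnatr_eq0 -leqn0 leqNgt bin_gt0 -ltnS ltM /=.
  by rewrite /= orbb => /eqP.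
have nei' : (i : nat) != m.+1 by apply: contraNneq nei => e; apply/eqP/val_inj.
have ltiM : (i < M.+1)%N := ltn_ord i.
rewrite -!exprD.
have [lti|gti|/eqP] := ltngtP i m.+1; last by rewrite (negPf nei').
  by rewrite [X in _ * X]Lbig ?mulr0 //; lia.
rewrite [L (_ ^+ (r - m.+1 + i))]Lbig ?mulr0 ?mul0r //; lia.
Qed.

(** Induction on the degree of an annihilator: either a linear factor can be removed, or the
    transvectant excludes two distinct roots, infinity included, and g is a power of one x - a. *)
Lemma annihilator_linear_power r g : (r <= n./2.+1)%N -> annihilates r g ->
  exists a, forall j, (m < j <= n)%N -> L (('X - a%:P) ^+ j) = 0.
Proof.
elim: r g => [|r IH] g ler Ag.
  case: (Ag) => g0 sg /(_ 1); rewrite size_poly1 ltnS => /(_ isT) /eqP.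
  have/size_poly1P [c c0 ->] : size g == 1%N.
    by rewrite eqn_leq sg size_poly_gt0.
  by rewrite mulr1 -alg_polyC linearZ /= mulf_eq0 (negPf c0) (negPf L1).
have len : (r.+1 <= n)%N by lia.
have bM : (M.+1 <= (n - r.+1).+2)%N by rewrite /M; lia.
have br : (r.+1 <= (n - M).+1)%N by rewrite /M; lia.
have IHroot b g1 : annihilates r.+1 (g1 * ('X - b%:P)) -> L g1 = 0 ->
    exists a, forall j, (m < j <= n)%N -> L (('X - a%:P) ^+ j) = 0.
  move=> A1 L0; have [g10 sg1] := size_divXsubC A1.
  apply: (IH g1); first lia; split=> // f sf.
  by rewrite (annihilator_root len A1) ?L0 ?mulr0 //; lia.
have g_nonconst : size g != 1%N.
  apply/negP => /size_poly1P [c c0 eg]; case: Ag => _ _ /(_ 1).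
  rewrite size_poly1 ltnS => /(_ isT) /eqP.
  by rewrite eg mulr1 -alg_polyC linearZ /= mulf_eq0 (negPf c0) (negPf L1).
have /closed_rootP [a ra] := g_nonconst.
have /factor_theorem [g1 eg] := ra.
have A1 := Ag; rewrite eg in A1; have [g10 sg1] := size_divXsubC A1.
have [La0|La] := eqVneq (L g1) 0; first exact: IHroot A1 La0.
have evalX b g2 i : annihilates r.+1 (g2 * ('X - b%:P)) -> (i <= M)%N ->
    L (g2 * 'X^i) = b ^+ i * L g2.
  move=> A2 leiM; rewrite (annihilator_root len A2) ?hornerXn //.
  by rewrite size_polyXn; lia.
(* Root at infinity, g being a form of degree r + 1. If L(g x^(n-r)) = 0 the degree drops. Otherwise
   g x^(n-r-M) and g/(x - a) leave only the term i = M, a product of two nonzero values. *)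
have [sg|sg] := leqP (size g) r.+1.
  have [L0|Linf] := eqVneq (L (g * 'X^((n - r.+1).+1))) 0.
    apply: (IH g); first lia; split=> //; first by case: Ag.
    move=> f sf; rewrite (annihilator_lead _ Ag) ?L0 ?mulr0 //; first lia.
  have sgX : (size (g * 'X^((n - r.+1).+1 - M))%R <= (n - M).+1)%N.
    by rewrite (leq_trans (size_polyMleq _ _)) // size_polyXn; lia.
  have := transv_polyE 0 sgX (leq_trans sg1 br).
  rewrite polyC0 subr0 big_ord_recr /= subnn expr0 mulr1 big1 => [|i _].
    rewrite add0r -(mulrA g) -exprD subnK; last by lia.
    move/eqP; rewrite !mulf_eq0 signr_eq0 binn oner_eq0.
    by rewrite (negPf Linf) (negPf La).
  rewrite -(mulrA g) -exprD (annihilator_lead _ Ag) //.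
    rewrite coefXn gtn_eqF ?mul0r ?mulr0 ?mul0r //.
    by have := ltn_ord i; lia.
  by rewrite size_polyXn; have := ltn_ord i; lia.
have [k [h rh eh]] := multiplicity_XsubC g a.
have g0 : g != 0 by case: Ag.
rewrite g0 /= in rh.
(* A root b of h is a second root of g. On g/(x - a) and g/(x - b) the transvectant sums to (b -
   a)^M L(g/(x - a)) L(g/(x - b)), nonzero once [Lb0] is excluded. *)
have [sh1|] := boolP (size h == 1%N); last first.
  move=> /closed_rootP [b rb].
  have nab : b - a != 0.
    by rewrite subr_eq0; apply: contraNneq rh => <-.
  have /factor_theorem [g2 eg2] : root g b by rewrite eh rootM rb.
  have A2 := Ag; rewrite eg2 in A2; have [g20 sg2] := size_divXsubC A2.
  have [Lb0|Lb] := eqVneq (L g2) 0; first exact: IHroot A2 Lb0.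
  have := transv_polyE 0 (leq_trans sg1 br) (leq_trans sg2 br).
  rewrite polyC0 subr0.
  rewrite (eq_bigr (fun i : 'I_M.+1 => (b ^+ (M - i) * a ^+ i *
    (-1) ^+ i *+ 'C(M, i)) * (L g1 * L g2))); last first.
    move=> i _; rewrite (evalX a) // ?(evalX b) ?leq_subr //; last first.
      by rewrite -ltnS.
    by rewrite -[_ *+ 'C(_, _)]mulr_natr; ring.
  rewrite -mulr_suml.
  rewrite (eq_bigr (fun i : 'I_M.+1 => (b ^+ (M - i) * (- a) ^+ i *+ 'C(M, i)))); last first.
    by move=> i _; rewrite [in RHS]exprNn [(-1) ^+ i * _]mulrC [in RHS]mulrA.
  rewrite -exprDn => /eqP; rewrite !mulf_eq0 expf_eq0.
  by rewrite (negPf nab) (negPf La) (negPf Lb) andbF.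
have /size_poly1P [c c0 ehc] := sh1.
have ek : k = r.+1.
  have sgr : size g = r.+2 by apply/eqP; rewrite eqn_leq sg andbT; case: Ag.
  move: sgr; rewrite eh ehc mul_polyC size_scale // size_exp_XsubC; lia.
have eg1 : g1 = c%:P * ('X - a%:P) ^+ r.
  have Xa0 : 'X - a%:P != 0 by rewrite polyXsubC_eq0.
  by apply: (mulIf Xa0); rewrite -eg eh ehc ek exprSr mulrA.
have Lar : L (('X - a%:P) ^+ r) != 0.
  by move: La; rewrite eg1 mul_polyC linearZ /= mulf_eq0 negb_or => /andP[].
have Lbig j : (r < j <= n)%N -> L (('X - a%:P) ^+ j) = 0.
  move=> /andP[ltrj lejn]; case: Ag => _ _.
  move=> /(_ (('X - a%:P) ^+ (j - r.+1))); rewrite size_exp_XsubC.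
  rewrite ltnS leq_sub2r // => /(_ isT) /eqP.
  rewrite eh ehc ek -mulrA -exprD subnKC //.
  by rewrite mul_polyC linearZ /= mulf_eq0 (negPf c0) => /eqP.
(* For r <= m [Lbig] suffices; for r > m, [Lar] contradicts [top_power_eq0]. *)
exists a => j /andP[ltmj lejn].
have [lerm|ltmr] := leqP r m; first by rewrite Lbig // (leq_ltn_trans lerm).
by case/eqP: Lar; apply: top_power_eq0; rewrite ?ltmr.
Qed.

Lemma linear_power_annihilator :
  exists a, forall j, (m < j <= n)%N -> L (('X - a%:P) ^+ j) = 0.
Proof.
(* For this r the Hankel matrix L(x^(i+j)) has more rows than columns; a left kernel vector is the
   coefficient vector of an annihilator. *)
set r := n./2.+1.
pose A : 'M[F]_(r.+1, (n - r).+1) := \matrix_(i, j) L ('X^(i + j)).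
have /rowV0Pn [v /sub_kermxP vA v0] : kermx A != 0.
  rewrite kermx_eq0 /row_free; apply/negP => /eqP rA.
  by have := rank_leq_col A; rewrite rA /r; lia.
pose g := \poly_(i < r.+1) v 0 (inord i).
apply: (@annihilator_linear_power r g); first exact: leqnn.
split; [|exact: size_poly|]; last first.
  move=> f sf; rewrite -{1}(coefK f) poly_def mulr_sumr linear_sum /=.
  rewrite big1 // => j _; rewrite -scalerAr linearZ /=.
  rewrite /g poly_def mulr_suml linear_sum /=.
  have /rowP /(_ (inord j)) := vA; rewrite !mxE => vAj.
  transitivity (f`_j * 0); last by rewrite mulr0.
  congr (_ * _); rewrite -[RHS]vAj.
  apply: eq_bigr => i _; rewrite !mxE -scalerAl -exprD linearZ /= inord_val.
  by rewrite inordK // (leq_trans (ltn_ord j)).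
apply: contraNneq v0 => g0; apply/eqP/rowP => i; rewrite mxE.
by have := coef_poly r.+1 (fun i => v 0 (inord i)) i; rewrite -/g g0 coef0 ltn_ord inord_val.
Qed.

End BinaryForms.

(** * Directional derivatives *)

Lemma iter_lincomb (F : comNzRingType) (E : lmodType F) (X Y : E -> E) a b n x :
    linear X -> linear Y -> (forall x, X (Y x) = Y (X x)) ->
  iter n (fun x => a *: X x + b *: Y x) x =
  \sum_(i < n.+1) (a ^+ (n - i) * b ^+ i *+ 'C(n, i)) *:
    iter (n - i) X (iter i Y x).
Proof.
move=> linX linY XY.
have lin_sum (Z : E -> E) k (c : 'I_k -> F) (z : 'I_k -> E) : linear Z ->
    Z (\sum_i c i *: z i) = \sum_i c i *: Z (z i).
  move=> lZ; have Z0 : Z 0 = 0 by have := lZ (-1) 0 0; rewrite scaler0 addr0 scaleN1r addNr.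
  by elim/big_rec2: _ => // i _ y _ <-; rewrite lZ.
have YXi k z : iter k X (Y z) = Y (iter k X z) by elim: k => //= k ->; rewrite XY.
elim: n => [|n IH]; first by rewrite big_ord1 /= mulr1 scale1r.
rewrite iterS IH. rewrite (lin_sum X) // (lin_sum Y) //. rewrite !scaler_sumr.
rewrite (eq_bigr (fun i : 'I_n.+1 => (a ^+ (n.+1 - i) * b ^+ i *+ 'C(n, i)) *:
   iter (n.+1 - i) X (iter i Y x))); last first.
  move=> i _; rewrite scalerA subSn; last by rewrite -ltnS.
  by rewrite iterS exprS -mulrA mulrnAr.
rewrite [X in _ + X](eq_bigr (fun i : 'I_n.+1 =>
   (a ^+ (n - i) * b ^+ i.+1 *+ 'C(n, i)) *: iter (n - i) X (iter i.+1 Y x))); last first.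
  move=> i _; rewrite scalerA iterS YXi.
  by rewrite exprS mulrnAr [_ * (b * _)]mulrCA.
rewrite big_ord_recl [RHS]big_ord_recl /= -addrA !bin0; congr (_ + _).
rewrite [RHS](eq_bigr (fun i : 'I_n.+1 =>
  (a ^+ (n - i) * b ^+ i.+1 *+ 'C(n, i.+1)) *: iter (n - i) X (iter i.+1 Y x) +
  (a ^+ (n - i) * b ^+ i.+1 *+ 'C(n, i)) *: iter (n - i) X (iter i.+1 Y x)));
  last by move=> i _; rewrite subSS binS mulrnDr scalerDl.
rewrite big_split /=; congr (_ + _).
by rewrite [RHS]big_ord_recr /= bin_small // mulr0n scale0r addr0.
Qed.

Lemma poly_eq0_everywhere (F : numFieldType) (p : {poly F}) :
  (forall t, p.[t] = 0) -> p = 0.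
Proof.
move=> p0; apply/eqP/negPn/negP => pn0.
have := @max_poly_roots F p [seq i%:R | i <- iota 0 (size p)] pn0.
rewrite size_map size_iota ltnn => H; apply: notF; apply: H.
  by apply/allP => x _; rewrite /root p0.
by rewrite map_inj_uniq ?iota_uniq //; apply: mulrIn; rewrite oner_eq0.
Qed.

Section DirectionalDerivative.
Variables (F : numFieldType) (W : vectType F).
Local Notation N := (\dim {:W}).
Local Notation poly := {mpoly F[N]}.
Implicit Types (u v w : W) (p q : poly).

Definition crd (v : W) (i : 'I_N) : F := coord (vbasis {:W}) i v.

Lemma crd_vbasis (i j : 'I_N) : crd (vbasis {:W})`_i j = (i == j)%:R.
Proof. by rewrite /crd coord_free ?(basis_free (vbasisP _)). Qed.

Definition dirder (v : W) (p : poly) : poly := \sum_i crd v i *: p^`M(i).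

Lemma dirder_is_linear v : linear (dirder v).
Proof.
move=> a p q; rewrite /dirder scaler_sumr -big_split /=; apply: eq_bigr => i _.
by rewrite linearP scalerDr !scalerA mulrC.
Qed.
HB.instance Definition _ v :=
  GRing.isLinear.Build F poly poly _ (dirder v) (dirder_is_linear v).

Lemma iter_dirder_is_linear v k : linear (iter k (dirder v)).
Proof.
elim: k => [|k IH] a p q //.
by rewrite !iterS IH linearP.
Qed.
HB.instance Definition _ v k :=
  GRing.isLinear.Build F poly poly _ (iter k (dirder v)) (iter_dirder_is_linear v k).

Lemma dirder_lincomb a b v w p :
  dirder (a *: v + b *: w) p = a *: dirder v p + b *: dirder w p.
Proof.
rewrite /dirder !scaler_sumr -big_split /=; apply: eq_bigr => i _.
by rewrite /crd linearP linearZ /= scalerDl !scalerA.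
Qed.

Lemma dirderC v w p : dirder v (dirder w p) = dirder w (dirder v p).
Proof.
rewrite /dirder.
under eq_bigr => i _ do rewrite (linear_sum (mderiv i)) scaler_sumr /=.
under [RHS]eq_bigr => i _ do rewrite (linear_sum (mderiv i)) scaler_sumr /=.
rewrite exchange_big /=; apply: eq_bigr => i _. apply: eq_bigr => j _.
by rewrite !linearZ /= mderiv_comm !scalerA mulrC.
Qed.

Lemma dirderM v p q : dirder v (p * q) = dirder v p * q + p * dirder v q.
Proof.
rewrite /dirder mulr_suml mulr_sumr -big_split /=; apply: eq_bigr => i _.
by rewrite mderivM scalerDr -scalerAl -scalerAr.
Qed.

Lemma dirder_homog v d p : p \is d.-homog -> dirder v p \is d.-1.-homog.
Proof.
move=> hp; apply: rpred_sum => i _; apply: rpredZ.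
apply/dhomogP => m; rewrite mcoeff_msupp mcoeff_mderiv => nz.
have mp : (m + U_(i))%MM \in msupp p.
  by rewrite mcoeff_msupp; apply: contraNneq nz => ->; rewrite mul0rn.
by have := dhomog_mf hp mp; rewrite /= mdegD mdeg1 addn1 => <-.
Qed.

Lemma iter_dirder_homog v k d p :
  p \is d.-homog -> iter k (dirder v) p \is (d - k).-homog.
Proof.
elim: k => [|k IH] hp; first by rewrite subn0.
by rewrite subnS iterS; apply: dirder_homog; apply: IH.
Qed.

Lemma iter_dirderC v w i j p :
  iter i (dirder v) (iter j (dirder w) p) = iter j (dirder w) (iter i (dirder v) p).
Proof. exact/iter_comm/dirderC. Qed.

Lemma dirder0 p : dirder 0 p = 0.
Proof. by rewrite /dirder big1 // => i _; rewrite /crd linear0 scale0r. Qed.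

Lemma euler d p v : p \is d.-homog -> (dirder v p).@[crd v] = d%:R * p.@[crd v].
Proof.
move=> hp; rewrite [in RHS](mpolyE p) [in LHS](mpolyE p).
rewrite (linear_sum (dirder v)) !(raddf_sum (meval (crd v))) /= mulr_sumr.
apply: eq_big_seq => m mp; rewrite [dirder v _]linearZ /= !mevalZ mulrCA.
congr (_ * _); rewrite -(dhomog_mf hp mp) /= mdegE natr_sum mulr_suml.
rewrite /dirder (raddf_sum (meval (crd v))) /=.
apply: eq_bigr => i _; rewrite mevalZ mderivX mevalZ mulrCA.
have [->|mi] := eqVneq (m i) 0%N; first by rewrite !mul0r.
congr (_ * _); rewrite -{1}[crd v i](mevalXU (crd v)) -mevalM -mpolyXD.
by rewrite addmC submK // lep1mP.
Qed.

Lemma homog0_eval p x : p \is 0.-homog -> p@_0%MM = p.@[x].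
Proof.
move=> hp; have -> : p = (p@_0%MM)%:MP; last by rewrite mcoeffC eqxx mulr1 mevalC.
apply/mpolyP => m; rewrite mcoeffC.
have [->|m0] := eqVneq m 0%MM; first by rewrite mulr1.
by rewrite mulr0 (dhomog_nemf_coeff hp) //= mdeg_eq0.
Qed.

Lemma iter_dirder_eval n p v : p \is n.-homog ->
  (iter n (dirder v) p)@_0%MM = n`!%:R * p.@[crd v].
Proof.
elim: n p => [|n IH] p hp; first by rewrite mul1r (homog0_eval (crd v)).
rewrite iterSr IH; last exact: dirder_homog hp.
by rewrite (euler v hp) mulrA -natrM mulnC -factS.
Qed.

(** Up to the factor n!, the polarization of p at n - i copies of v and i copies of w. For p of
    degree n the derivatives leave a constant, read off as the coefficient at 0. *)
Definition polar_coef n v w i p : F :=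
  (iter (n - i) (dirder v) (iter i (dirder w) p))@_0%MM.

Lemma polar_coef_is_scalar n v w i : scalar (polar_coef n v w i).
Proof. by move=> a p q; rewrite /polar_coef !linearP. Qed.
HB.instance Definition _ n v w i :=
  GRing.isLinear.Build F poly F _ (polar_coef n v w i) (polar_coef_is_scalar n v w i).

Lemma eval_lincomb n p v w a b : p \is n.-homog ->
  n`!%:R * p.@[crd (a *: v + b *: w)] =
  \sum_(i < n.+1) (a ^+ (n - i) * b ^+ i *+ 'C(n, i)) * polar_coef n v w i p.
Proof.
move=> hp; rewrite -iter_dirder_eval //.
rewrite (eq_iter (dirder_lincomb a b v w)).
rewrite (iter_lincomb _ _ _ _ (dirder_is_linear v) (dirder_is_linear w) (dirderC v w)).
by rewrite linear_sum /=; apply: eq_bigr => i _; rewrite mcoeffZ.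
Qed.

(** Up to binomials and n!, these numbers are the coefficients in t of the restriction to the line v
    + t w. *)
Lemma polar_coef_inj n v w v' w' p p' :
    p \is n.-homog -> p' \is n.-homog ->
    (forall t, p.@[crd (v + t *: w)] = p'.@[crd (v' + t *: w')]) ->
  forall i, (i <= n)%N -> polar_coef n v w i p = polar_coef n v' w' i p'.
Proof.
move=> hp hp' pp' i lein.
pose H := \poly_(i < n.+1) ((polar_coef n v w i p - polar_coef n v' w' i p') *+ 'C(n, i)).
have H0 : H = 0.
  apply: poly_eq0_everywhere => t; rewrite horner_poly.
  have := congr1 (fun x => n`!%:R * x) (pp' t).
  rewrite -[v]scale1r -[v']scale1r !eval_lincomb // !scale1r => /eqP.
  rewrite -subr_eq0 -sumrB => /eqP; rewrite -[RHS]/0 => {2}<-.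
  apply: eq_bigr => j _; rewrite !expr1n !mul1r -mulrBr.
  by rewrite !mulrnAl mulrC.
have := congr1 (fun h : {poly F} => h`_i) H0; rewrite coef_poly ltnS lein coef0.
move/eqP; rewrite mulrn_eq0 -leqn0 leqNgt bin_gt0 lein /= subr_eq0 => /eqP //.
Qed.

(** Induction on the degree: on each line x + t w the coefficient of t vanishes, so D_w p vanishes
    everywhere and is 0; the partial derivatives then give all coefficients. *)
Lemma homog_eq0 n p : p \is n.-homog -> (forall x, p.@[crd x] = 0) -> p = 0.
Proof.
elim: n p => [|n IH] p hp p0.
  apply/mpolyP => m; rewrite mcoeff0.
  have [->|m0] := eqVneq m 0%MM; first by rewrite (homog0_eval (crd 0)).
  by rewrite (dhomog_nemf_coeff hp) //= mdeg_eq0.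
have D0 w : dirder w p = 0.
  apply: IH => [|x]; first exact: dirder_homog hp.
  have /eqP := iter_dirder_eval x (dirder_homog w hp).
  have := @polar_coef_inj n.+1 x w x w p 0 hp (rpred0 _).
  move=> /(_ (fun t => etrans (p0 _) (esym (meval0 _))) 1%N isT).
  rewrite [RHS]linear0 /polar_coef subn1 /= => ->.
  by rewrite eq_sym mulf_eq0 pnatr_eq0 -leqn0 leqNgt fact_gt0 /= => /eqP.
apply/mpolyP => m; rewrite mcoeff0.
have [m0|m0] := eqVneq m 0%MM.
  by rewrite (dhomog_nemf_coeff hp) //= m0 mdeg0.
have [i mi] : exists i, m i != 0%N.
  apply/existsP; apply: contraNT m0; rewrite negb_exists => /forallP m0.
  by apply/eqP/mnmP => i; rewrite mnm0E; apply/eqP; move: (m0 i); rewrite negbK.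
have := congr1 (mcoeff (m - U_(i))) (D0 (vbasis {:W})`_i).
rewrite /dirder (bigD1 i) //= big1 => [|j ji]; last first.
  by rewrite crd_vbasis eq_sym (negPf ji) scale0r.
rewrite crd_vbasis eqxx scale1r addr0.
rewrite mcoeff_mderiv submK ?lep1mP // mcoeff0 => /eqP.
by rewrite mulrn_eq0 /= => /eqP.
Qed.

Lemma homog_neq0 n p : p \is n.-homog -> p != 0 -> exists x, p.@[crd x] != 0.
Proof.
move=> hp; apply: contra_neqP => H; apply: (homog_eq0 hp) => x.
by apply/eqP/negPn/negP => px; apply: H; exists x.
Qed.

End DirectionalDerivative.

(** * Vanishing transvectants and padded polynomials *)

Section Padded.
Variables (F : numClosedFieldType) (W : vectType F).
Local Notation N := (\dim {:W}).
Local Notation poly := {mpoly F[N]}.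
Implicit Types (u v w : W) (p q : poly).

Lemma dirder_homog0 v p : p \is 0.-homog -> dirder v p = 0.
Proof.
move=> hp; apply/(@homog_eq0 _ _ 0) => [|x]; first exact: (dirder_homog v hp).
rewrite /dirder (raddf_sum (meval _)) big1 // => i _ /=.
have -> : p = (p@_0%MM)%:MP.
  apply/mpolyP => m; rewrite mcoeffC.
  have [->|m0] := eqVneq m 0%MM; first by rewrite mulr1.
  by rewrite mulr0 (dhomog_nemf_coeff hp) //= mdeg_eq0.
by rewrite mderivC scaler0 meval0.
Qed.

Lemma iter_dirder_homog_gt v k d p : p \is d.-homog -> (d < k)%N ->
  iter k (dirder v) p = 0.
Proof.
move=> hp ltdk; rewrite -(subnK ltdk) iterD iterS dirder_homog0 ?linear0 //.
by have := iter_dirder_homog v d hp; rewrite subnn.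
Qed.

Lemma dirder_linear_form v p : p \is 1.-homog -> dirder v p = (p.@[crd v])%:MP.
Proof.
move=> hp; apply/eqP; rewrite -subr_eq0; apply/eqP.
have h0 : dirder v p - (p.@[crd v])%:MP \is 0.-homog.
  by rewrite rpredB ?(dirder_homog v hp) // -alg_mpolyC rpredZ // dhomog1.
apply: (homog_eq0 h0) => x; rewrite mevalB mevalC -(homog0_eval _ (dirder_homog v hp)).
by rewrite -[dirder v p]/(iter 1 (dirder v) p) iter_dirder_eval // mul1r subrr.
Qed.

Lemma iter_dirder_padded u (l h : poly) a m k : l \is 1.-homog ->
    h \is m.-homog -> l.@[crd u] = 0 -> (m < k)%N ->
  iter k (dirder u) (l ^+ a * h) = 0.
Proof.
move=> hl hh lu ltmk.
have Dl : dirder u l = 0 by rewrite dirder_linear_form // lu mpolyC0.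
have Dla : dirder u (l ^+ a) = 0.
  elim: a => [|a IH]; first exact/dirder_homog0/dhomog1.
  by rewrite exprS dirderM Dl IH mul0r mulr0 addr0.
have -> : iter k (dirder u) (l ^+ a * h) = l ^+ a * iter k (dirder u) h.
  by elim: k {ltmk} => //= k ->; rewrite dirderM Dla mul0r add0r.
by rewrite (iter_dirder_homog_gt _ hh ltmk) mulr0.
Qed.

(** Shear w to a vector u with l(u) = 0. The two factors of a term contain i and M - i derivatives
    along u, and one of these numbers exceeds m. If l(e) = 0 already, e takes the place of u. *)
Lemma transv_padded (l h : poly) a m M e w (phi psi : poly -> F) :
    l \is 1.-homog -> h \is m.-homog -> (m.*2 < M)%N ->
    scalar phi -> scalar psi ->
  transv (dirder e) (dirder w) M phi psi (l ^+ a * h) (l ^+ a * h) = 0.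
Proof.
move=> hl hh ltM sphi spsi.
have phi0 : phi 0 = 0 by have := sphi (-1) 0 0; rewrite scaler0 addr0 mulN1r addNr.
have psi0 : psi 0 = 0 by have := spsi (-1) 0 0; rewrite scaler0 addr0 mulN1r addNr.
have [le|le] := eqVneq l.@[crd e] 0.
  rewrite transvE; last exact: dirderC.
  rewrite big1 // => i _.
  have [lti|gei] := ltnP m i.
    rewrite [X in _ * psi X](iter_dirderC e) (iter_dirder_padded a hl hh le) //.
    by rewrite ?linear0 // psi0 mulr0.
  rewrite (iter_dirderC e) (iter_dirder_padded a hl hh le) ?linear0 ?phi0 ?mulr0 ?mul0r //.
  by have := ltn_ord i; lia.
pose c := - (l.@[crd w] / l.@[crd e]); pose u := 1 *: w + c *: e.
have lu : l.@[crd u] = 0.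
  have lin (v : W) : l.@[crd v] = (dirder v l)@_0%MM.
    by rewrite dirder_linear_form // mcoeffC eqxx mulr1.
  by rewrite lin dirder_lincomb mcoeffD !mcoeffZ -!lin mul1r mulNr divfK // subrr.
rewrite -(@transv_shear _ _ _ _ M c) //; try exact: dirder_is_linear.
have -> : (fun x => dirder w x + c *: dirder e x) = dirder u.
  by apply: funext => x; rewrite dirder_lincomb scale1r.
rewrite transvE; last exact: dirderC.
rewrite big1 // => i _.
have [lti|gei] := ltnP m i.
  by rewrite (iter_dirder_padded a hl hh lu) ?linear0 ?phi0 ?mulr0 ?mul0r.
rewrite [iter (M - i) (dirder u) _](iter_dirder_padded a hl hh lu) ?linear0 ?psi0 ?mulr0 //.
by have := ltn_ord i; lia.
Qed.

(** * Polynomials whose transvectants of order 2m + 1 vanish *)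

Section Converse.
Variables (n m M : nat) (P : poly).
Hypotheses (hP : P \is n.-homog) (lt4mn : (4 * m < n)%N).
Hypothesis eM : M = m.*2.+1.
Hypothesis P_transv : forall e w (phi psi : poly -> F), scalar phi -> scalar psi ->
  transv (dirder e) (dirder w) M phi psi P P = 0.


Lemma P_transvE e w (phi psi : poly -> F) : scalar phi -> scalar psi ->
  \sum_(i < M.+1) (-1) ^+ i * 'C(M, i)%:R *
    phi (iter (M - i) (dirder e) (iter i (dirder w) P)) *
    psi (iter i (dirder e) (iter (M - i) (dirder w) P)) = 0.
Proof.
by move=> sphi spsi; rewrite -transvE ?P_transv //; apply: dirderC.
Qed.

Lemma polar_coef_transv e w l k : (l <= n - M)%N -> (k <= n - M)%N ->
  \sum_(i < M.+1) (-1) ^+ i * 'C(M, i)%:R *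
    polar_coef n e w (l + i) P * polar_coef n e w (k + (M - i)) P = 0.
Proof.
move=> lel lek.
(* The n - M derivatives still missing turn each factor into a polarization coefficient. *)
pose phi j p := (iter (n - M - j) (dirder e) (iter j (dirder w) p))@_0%MM.
have sphi j : scalar (phi j) by move=> a p q; rewrite /phi !linearP.
rewrite -[RHS](P_transvE e w (sphi l) (sphi k)); apply: eq_bigr => i _.
have ltiM : (i < M.+1)%N := ltn_ord i.
congr (_ * _ * _); rewrite /phi /polar_coef.
  rewrite -(iter_dirderC e w (M - i) l) -!iterD.
  by congr ((iter _ _ _)@__); lia.
rewrite -(iter_dirderC e w i k) -!iterD.
by congr ((iter _ _ _)@__); lia.
Qed.

Lemma exists_polar_root e w : P.@[crd e] != 0 ->
  exists a, forall j, (m < j <= n)%N -> polar_coef n e (w - a *: e) j P = 0.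
Proof.
move=> Pe; pose A i := polar_coef n e w i P.
(* L carries the restriction of P to the span of e and w; coefficients beyond degree n are ignored,
   so that L is linear on all polynomials. *)
pose L (f : {poly F}) := \sum_(i < n.+1) f`_i * A i.
have sL : scalar L.
  move=> a f g; rewrite /L mulr_sumr -big_split /=; apply: eq_bigr => i _.
  by rewrite coefD coefZ mulrDl mulrA.
pose lL : {scalar {poly F}} := HB.pack L (GRing.isLinear.Build F {poly F} F *%R L sL).
have LX i : (i <= n)%N -> L 'X^i = A i.
  rewrite -ltnS => lti; rewrite /L (bigD1 (Ordinal lti)) //= coefXn eqxx mul1r.
  rewrite big1 ?addr0 // => j ji; rewrite coefXn.
  rewrite (_ : (j == i :> nat) = false) ?mul0r //.
  by apply: contraNF ji => /eqP e1; apply/eqP/val_inj.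
have LMX k i (f : {poly F}) : (size f <= k)%N -> (k + i <= n.+1)%N ->
    L (f * 'X^i) = \sum_(j < k) f`_j * A (j + i)%N.
  move=> sf lek; have {1}-> : f = \sum_(j < k) f`_j *: 'X^j.
    rewrite -poly_def; apply/polyP => j; rewrite coef_poly.
    by case: ltnP => // lekj; rewrite nth_default // (leq_trans sf).
  rewrite mulr_suml -[L _]/(lL _) linear_sum; apply: eq_bigr => j _.
  rewrite -scalerAl -exprD linearZ /= LX //.
  by have := ltn_ord j; lia.
have [|f h sf sh|a Ha] := @linear_power_annihilator F L n m sL _ lt4mn.
- rewrite -(expr0 'X) LX // /A /polar_coef subn0 /= iter_dirder_eval //.
  by rewrite mulf_neq0 // pnatr_eq0 -lt0n fact_gt0.
- rewrite -eM in sf sh *; rewrite transvE //.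
  have iter_id k (x : {poly F}) : iter k id x = x by elim: k.
  under eq_bigr => i _ do rewrite !iter_id !iter_rmul.
  (* Expanding f and h in powers of x gives a combination of the relations [polar_coef_transv]. *)
  rewrite (eq_bigr (fun i : 'I_M.+1 => \sum_(j < (n - M).+1) \sum_(k < (n - M).+1)
    f`_j * h`_k * ((-1) ^+ i * 'C(M, i)%:R * A (j + i)%N * A (k + (M - i))%N))); last first.
    move=> i _; have ltiM : (i < M.+1)%N := ltn_ord i.
    rewrite !(LMX (n - M).+1) //; try lia.
    rewrite -mulrA big_distrlr mulr_sumr; apply: eq_bigr => j _.
    by rewrite mulr_sumr; apply: eq_bigr => k _ /=; ring.
  rewrite exchange_big big1 //= => j _; rewrite exchange_big big1 //= => k _.
  by rewrite -mulr_sumr polar_coef_transv ?mulr0 // -ltnS.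
exists a => j /andP[ltmj lejn].
rewrite -[RHS](Ha j) ?ltmj // /polar_coef.
(* The power of D_w - a D_e expands like (x - a)^j, with D_w in place of x. *)
have -> : dirder (w - a *: e) = (fun p => 1 *: dirder w p + (- a) *: dirder e p).
  by apply: funext => p; rewrite -dirder_lincomb scale1r scaleNr.
rewrite (iter_lincomb _ _ _ _ (dirder_is_linear w) (dirder_is_linear e) (dirderC w e)).
rewrite !linear_sum /=.
rewrite -[L _]/(lL _) exprDn linear_sum; apply: eq_bigr => i _.
have ltij : (i < j.+1)%N := ltn_ord i.
rewrite !linearZ expr1n mul1r linearMn -polyCN -polyC_exp [_ * _%:P]mulrC.
rewrite mul_polyC linearZ /= LX; last lia.
rewrite mulrnAl; congr (_ * _ *+ _).
rewrite -(iter_dirderC e) -iterD /A /polar_coef.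
by congr ((iter _ _ _)@__); lia.
Qed.

(** Let j <= m be maximal with A_j != 0, and let psi complete M derivatives to the index j. The
    terms i < M involve A_(j+M-i) = 0; the last one is a coefficient of D_u^M P times A_j. *)
Lemma iter_dirder_isotropic e u : P.@[crd e] != 0 ->
    (forall j, (m < j <= n)%N -> polar_coef n e u j P = 0) ->
  iter M (dirder u) P = 0.
Proof.
move=> Pe Pu; pose A i := polar_coef n e u i P.
have A0 : A 0%N != 0.
  rewrite /A /polar_coef subn0 /= iter_dirder_eval //.
  by rewrite mulf_neq0 // pnatr_eq0 -lt0n fact_gt0.
have [j Aj maxj] : exists2 j, A j != 0 & forall i, (i <= n)%N -> (j < i)%N -> A i = 0.
  have [|j jn maxj] := @ex_maxnP (fun j => (j <= n)%N && (A j != 0)) n (ex_intro _ 0%N A0).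
    by move=> i /andP[].
  case/andP: jn => jn Aj; exists j => // i lein ltji; apply/eqP/negPn/negP => Ai.
  by have := maxj i; rewrite lein Ai => /(_ isT); rewrite leqNgt ltji.
have lejm : (j <= m)%N.
  rewrite leqNgt; apply/negP => ltmj; case/eqP: Aj.
  have [lejn|] := leqP j n; first by rewrite /A Pu ?ltmj.
  by move=> ltnj; rewrite /A /polar_coef (iter_dirder_homog_gt u hP ltnj) linear0 mcoeff0.
apply/mpolyP => mon; rewrite mcoeff0.
pose psi p := (iter (n - M - j) (dirder e) (iter j (dirder u) p))@_0%MM.
have sphi : scalar (mcoeff mon : poly -> F) by move=> a p q; rewrite linearP.
have spsi : scalar psi by move=> a p q; rewrite /psi !linearP.
have := P_transvE e u sphi spsi; rewrite big_ord_recr /= subnn big1 ?add0r.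
  rewrite /psi /= -(iter_dirderC e u) -iterD.
  have -> : (n - M - j + M = n - j)%N by lia.
  move/eqP; rewrite !mulf_eq0 signr_eq0 binn oner_eq0 /= -/(polar_coef n e u j P).
  by rewrite -/(A j) (negPf Aj) orbF => /eqP.
move=> i _; have ltiM : (i < M)%N := ltn_ord i.
rewrite /psi -(iter_dirderC e u) -!iterD.
have := maxj (j + (M - i))%N; rewrite /A /polar_coef.
have -> : (n - (j + (M - i)) = n - M - j + i)%N by lia.
by move=> ->; rewrite ?mulr0 //; lia.
Qed.

(* For j > m maximal with D_u^j P != 0, a single term of the transvectant of order
   2m + 1 survives: a product of values of D_e^m D_u^j P and D_e^(m+1) D_u^j P. *)
Lemma iter_dirder_sharp u : iter M (dirder u) P = 0 -> iter m.+1 (dirder u) P = 0.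
Proof.
move=> PM; apply/eqP/negPn/negP => Pm.
have up i : (M <= i)%N -> iter i (dirder u) P = 0.
  by move=> leMi; rewrite -(subnK leMi) iterD PM linear0.
have [|j Qj maxj] := @ex_maxnP (fun j => iter j (dirder u) P != 0) M (ex_intro _ m.+1 Pm).
  by move=> i; rewrite leqNgt; apply: contraNN => /ltnW/up ->.
have ltmj : (m < j)%N by exact: maxj.
have ltjM : (j < M)%N by rewrite ltnNge; apply: contraNN Qj => /up ->.
have up' i : (j < i)%N -> iter i (dirder u) P = 0.
  by move=> ltji; apply/eqP/negPn/negP => /maxj; rewrite leqNgt ltji.
set Q := iter j (dirder u) P in Qj.
have hQ : Q \is (n - j).-homog by exact: iter_dirder_homog.
have [e Qe] := homog_neq0 hQ Qj.
(* Q has degree n - j >= 2m + 1, since j <= 2m and 4m < n; this leaves room for m + 1 derivatives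
   along e. *)
have eQ i : (i <= n - j)%N -> iter i (dirder e) Q != 0.
  move=> lei; apply: contraNneq Qe => Q0.
  have := iter_dirder_eval e hQ; rewrite -(subnK lei) iterD Q0 linear0 mcoeff0.
  by move/esym/eqP; rewrite mulf_eq0 pnatr_eq0 -leqn0 leqNgt fact_gt0.
have [f1 Hf1] : exists f1, (iter m (dirder e) Q)@_f1 != 0.
  have /eQ : (m <= n - j)%N by lia.
  by exists (mlead (iter m (dirder e) Q)); rewrite mleadc_eq0.
have [f2 Hf2] : exists f2, (iter m.+1 (dirder e) Q)@_f2 != 0.
  have /eQ : (m.+1 <= n - j)%N by lia.
  by exists (mlead (iter m.+1 (dirder e) Q)); rewrite mleadc_eq0.
pose phi p := (iter (j - m.+1) (dirder u) p)@_f1.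
pose psi p := (iter (j - m) (dirder u) p)@_f2.
have sphi : scalar phi by move=> a p q; rewrite /phi !linearP.
have spsi : scalar psi by move=> a p q; rewrite /psi !linearP.
have ltM : (m.+1 < M.+1)%N by lia.
have := P_transvE e u sphi spsi.
(* phi meets D_u^(j-m-1+i) and psi meets D_u^(j+m+1-i); only i = m + 1 keeps both exponents at most
   j. *)
rewrite (bigD1 (Ordinal ltM)) //= big1 ?addr0 => [|i nei].
  rewrite -!iterS /phi /psi -!(iter_dirderC e u) -!iterD.
  have -> : (j - m.+1 + m.+1 = j)%N by lia.
  have -> : (j - m + (M - m.+1) = j)%N by lia.
  have -> : (M - m.+1 = m)%N by lia.
  move/eqP; rewrite !mulf_eq0 signr_eq0 pnatr_eq0 -leqn0 leqNgt bin_gt0 -ltnS ltM /=.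
  by rewrite -/Q (negPf Hf1) (negPf Hf2).
have ltiM : (i < M.+1)%N := ltn_ord i.
rewrite /phi /psi -!(iter_dirderC e u) -!iterD.
have [lti|gti|ei] := ltngtP i m.+1; last by case/eqP: nei; apply: val_inj.
  by rewrite (up' (j - m + (M - i))%N) ?linear0 ?mcoeff0 ?mulr0 //; lia.
by rewrite (up' (j - m.+1 + i)%N) ?linear0 ?mcoeff0 ?mulr0 ?mul0r //; lia.
Qed.

End Converse.
End Padded.

(** * Linear functionals as polynomials of degree one *)

Section LinearForms.
Variables (F : numFieldType) (V : vectType F).
Implicit Type f : V -> F.

Definition linform f : {mpoly F[\dim {:V}]} :=
  \sum_(i < \dim {:V}) f (vbasis {:V})`_i *: 'X_i.

Lemma linform_homog f : linform f \is 1.-homog.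
Proof.
by apply: rpred_sum => i _; apply: rpredZ; rewrite dhomogX; apply/eqP; exact: mdeg1.
Qed.

Lemma linform_eval f v : scalar f -> (linform f).@[crd v] = f v.
Proof.
move=> sf; pose lf : {scalar V} := HB.pack f (GRing.isLinear.Build F V F *%R f sf).
rewrite /linform (raddf_sum (meval _)) [in RHS](coord_vbasis (memvf v)).
rewrite -[RHS]/(lf _) linear_sum; apply: eq_bigr => i _ /=.
by rewrite mevalZ mevalXU -[RHS]/(lf _) linearZ mulrC.
Qed.

Lemma heval_crd d (p : hpoly d V) v : heval p v = (p : {mpoly F[_]}).@[crd v].
Proof. by []. Qed.

End LinearForms.

(** Write x = l(x) e + pi(x) with D_(pi x)^(m+1) P = 0. In the expansion of P(x) the terms with more
    than m copies of pi(x) vanish, so l^(n-m) factors out and h collects the rest. *)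
Lemma padded_of_transv (F : numClosedFieldType) (W : vectType F) (n m M : nat)
    (P : hpoly n W) : (4 * m < n)%N -> M = m.*2.+1 ->
    (forall e w (phi psi : {mpoly F[_]} -> F), scalar phi -> scalar psi ->
      transv (dirder e) (dirder w) M phi psi (P : {mpoly F[_]}) P = 0) ->
  padded m P.
Proof.
move=> lt4mn eM P_transv; have hP := dhomog_is_dhomog P.
have [P0|Pn0] := eqVneq (P : {mpoly F[_]}) 0.
  exists 0, 0; rewrite P0 mulr0 //.
have [e Pe] := homog_neq0 hP Pn0.
pose H u := iter m.+1 (dirder u) P = 0.
have H0 : H 0 by rewrite /H iterS dirder0.
(* Each term of D_(a u + v)^M has at least m + 1 copies of D_u or of D_v; [iter_dirder_sharp] then
   lowers the exponent from M to m + 1. *)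
have HD a u v : H u -> H v -> H (a *: u + v).
  move=> Hu Hv; apply: (iter_dirder_sharp hP lt4mn eM P_transv).
  have -> : dirder (a *: u + v) = (fun p => a *: dirder u p + 1 *: dirder v p).
    by apply: funext => p; rewrite -dirder_lincomb scale1r.
  rewrite (iter_lincomb _ _ _ _ (dirder_is_linear u) (dirder_is_linear v) (dirderC u v)).
  rewrite big1 // => i _; have ltiM : (i < M.+1)%N := ltn_ord i.
  have Hbig v' k : H v' -> (m < k)%N -> iter k (dirder v') P = 0.
    by move=> Hv' ltmk; rewrite -(subnK ltmk) iterD Hv' linear0.
  have [ltmi|leim] := ltnP m i; first by rewrite (Hbig v) // linear0 scaler0.
  by rewrite iter_dirderC (Hbig u) ?linear0 ?scaler0 //; lia.
have /choice[th Hth] w : exists a, H (w - a *: e).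
  have [a Ha] := exists_polar_root hP lt4mn eM P_transv w Pe.
  exists a; apply: (iter_dirder_sharp hP lt4mn eM P_transv).
  exact: (iter_dirder_isotropic hP lt4mn eM P_transv Pe).
(* [th] is a mere choice; its values on the basis are extended linearly, which [HD] allows. *)
pose l w := \sum_(i < \dim {:W}) crd w i * th (vbasis {:W})`_i.
have sl : scalar l.
  move=> a u v; rewrite /l mulr_sumr -big_split /=; apply: eq_bigr => i _.
  by rewrite /crd linearP /= mulrDl mulrA.
have Hl w : H (w - l w *: e).
  have -> : w - l w *: e =
      \sum_(i < \dim {:W}) crd w i *: ((vbasis {:W})`_i - th (vbasis {:W})`_i *: e).
    rewrite {1}(coord_vbasis (memvf w)) /l scaler_suml -sumrB.
    by apply: eq_bigr => i _; rewrite scalerBr scalerA.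
  by elim/big_rec: _ => // i u _ Hu; apply: HD.
have lpi : linear (fun w => w - l w *: e).
  move=> a u v; rewrite sl scalerDl opprD scalerBr -scalerA addrACA.
  by rewrite scalerA.
pose pi : 'End(W) := linfun (HB.pack (fun w => w - l w *: e)
  (GRing.isLinear.Build F W W _ (fun w => w - l w *: e) lpi) : {linear W -> W}).
have piE w : pi w = w - l w *: e by rewrite lfunE.
have hG i : (i <= n)%N -> iter (n - i) (dirder e) P \is i.-homog.
  by move=> lein; have := iter_dirder_homog e (n - i) hP; rewrite subKn.
pose G i : hpoly i W := indhomog i (iter (n - i) (dirder e) P).
have GE i : (i <= n)%N -> (G i : {mpoly F[_]}) = iter (n - i) (dirder e) P.
  by move=> lein; rewrite /G /indhomog; apply: (insubdK _ (hG i lein)).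
(* The factor i! appears because D_e^(n-i) P has degree i and is differentiated i times along
   pi(x). *)
pose c i : F := 'C(n, i)%:R * i`!%:R / n`!%:R.
pose h : {mpoly F[_]} := \sum_(i < m.+1)
  c i *: (linform l ^+ (m - i) * (pullback pi (G i) : {mpoly F[_]})).
have hh : h \is m.-homog.
  apply: rpred_sum => i _; apply: rpredZ.
  have leim : (i <= m)%N by rewrite -ltnS.
  have := dhomogM (dhomogMn (m - i) (linform_homog l)) (pullback_homog pi (G i)).
  by rewrite mul1n subnK.
exists (DHomog (linform_homog l)), (DHomog hh) => /=.
apply/eqP; rewrite -subr_eq0; apply/eqP.
have ltmn : (m < n)%N by lia.
have hlh : linform l ^+ (n - m) * h \is n.-homog.
  have := dhomogM (dhomogMn (n - m) (linform_homog l)) hh.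
  by rewrite mul1n subnK // ltnW.
apply: (@homog_eq0 _ _ n) => [|x]; first exact: rpredB.
rewrite mevalB mevalM rmorphXn /= linform_eval //.
apply/eqP; rewrite subr_eq0; apply/eqP.
have fn0 : n`!%:R != 0 :> F by rewrite pnatr_eq0 -lt0n fact_gt0.
apply: (mulfI fn0); have ex : x = l x *: e + 1 *: pi x.
  by rewrite piE scale1r addrC subrK.
rewrite {1}ex eval_lincomb //.
rewrite -(big_mkord xpredT (fun i => (l x ^+ (n - i) * 1 ^+ i *+ 'C(n, i)) *
  polar_coef n e (pi x) i P)).
rewrite (big_cat_nat _ (n := m.+1)) //=; last exact: ltnW.
rewrite [X in _ + X]big1_seq ?addr0 => [|i]; last first.
  rewrite mem_index_iota => /andP[_ /andP[ltmi _]].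
  rewrite /polar_coef -(subnK ltmi) (iterD _ m.+1) piE Hl.
  by rewrite !linear0 mulr0.
rewrite big_mkord /h (raddf_sum (meval _)) !mulr_sumr; apply: eq_bigr => i _ /=.
have leim : (i <= m)%N by rewrite -ltnS.
have lein : (i <= n)%N := leq_trans leim (ltnW ltmn).
rewrite mevalZ mevalM rmorphXn /= linform_eval //.
have -> : (pullback pi (G i) : {mpoly F[_]}).@[crd x] =
          (G i : {mpoly F[_]}).@[crd (pi x)] by exact: heval_pullback.
rewrite GE // /polar_coef iter_dirderC iter_dirder_eval ?hG // expr1n mulr1.
have -> : (n - i = (n - m) + (m - i))%N by lia.
rewrite exprD /c -mulr_natr; field.
exact: fn0.
Qed.

(** * Quadratic forms *)

Section QuadraticForms.
Variables (F : numClosedFieldType) (V : vectType F).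
Implicit Types (q : hpoly 2 V) (v w : V) (f g : V -> F).

Lemma heval_eq0 d (p : hpoly d V) : (forall v, heval p v = 0) -> p = 0.
Proof.
by move=> p0; apply: val_inj; apply: (homog_eq0 (dhomog_is_dhomog p)).
Qed.

Definition eval_at d v (p : hpoly d V) : F := heval p v.

Lemma eval_at_is_scalar d v : scalar (@eval_at d v).
Proof. by move=> a p q; rewrite /eval_at /heval mevalD mevalZ. Qed.

HB.instance Definition _ d v :=
  GRing.isLinear.Build F (hpoly d V) F *%R (@eval_at d v) (@eval_at_is_scalar d v).

Definition prodq f g : hpoly 2 V :=
  DHomog (dhomogM (linform_homog f) (linform_homog g)).

Lemma heval_prodq f g v : scalar f -> scalar g -> heval (prodq f g) v = f v * g v.
Proof. by move=> sf sg; rewrite heval_crd /= mevalM !linform_eval. Qed.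

Definition pol q v w : F := (dirder v (dirder w (q : {mpoly F[_]})))@_0%MM.

Lemma pol_sym q v w : pol q v w = pol q w v.
Proof. by rewrite /pol dirderC. Qed.

Lemma pol_scalarr q v : scalar (pol q v).
Proof.
move=> a u w; rewrite ![pol q v _]pol_sym /pol -[w in LHS]scale1r dirder_lincomb.
by rewrite mcoeffD !mcoeffZ mul1r.
Qed.
HB.instance Definition _ q v :=
  GRing.isLinear.Build F V F *%R (pol q v) (pol_scalarr q v).

Definition pol_at v w q : F := pol q v w.

Lemma pol_at_is_scalar v w : scalar (pol_at v w).
Proof. by move=> a p q; rewrite /pol_at /pol !linearP. Qed.
HB.instance Definition _ v w :=
  GRing.isLinear.Build F (hpoly 2 V) F *%R (pol_at v w) (pol_at_is_scalar v w).

Lemma pol_diag q v : pol q v v = heval q v *+ 2.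
Proof.
have := iter_dirder_eval v (dhomog_is_dhomog q).
by rewrite /pol /= => ->; rewrite -[RHS]mulr_natl.
Qed.

Lemma pol_heval q v w : pol q v w = heval q (v + w) - heval q v - heval q w.
Proof.
have H : pol q (v + w) (v + w) = pol q v v + pol q w w + pol q v w *+ 2.
  rewrite (linearD (pol q (v + w))) /=.
  rewrite [pol q (v + w) v]pol_sym [pol q (v + w) w]pol_sym.
  rewrite (linearD (pol q v)) (linearD (pol q w)) /= (pol_sym q w v) mulr2n.
  by ring.
apply: (mulfI (_ : 2%:R != 0)); first by rewrite pnatr_eq0.
move: H; rewrite !pol_diag => H.
by rewrite mulr_natl !mulrBr !mulr_natl H; ring.
Qed.

Lemma pol_prodq f g v w : scalar f -> scalar g ->
  pol (prodq f g) v w = f v * g w + f w * g v.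
Proof.
move=> sf sg; rewrite /pol /= dirderM. rewrite !(dirder_linear_form _ (linform_homog _)).
rewrite linearD /= ![dirder v (_ * _)]dirderM.
rewrite !(dirder_linear_form _ (linform_homog _)) !(dirder_homog0 v) ?mul0r ?mulr0; last 2 first.
- by rewrite -alg_mpolyC rpredZ // dhomog1.
- by rewrite -alg_mpolyC rpredZ // dhomog1.
rewrite add0r addr0 mcoeffD -!mpolyCM !mcoeffC !eqxx !mulr1 !linform_eval //.
by rewrite addrC [RHS]addrC addrC.
Qed.

Lemma pol_eq0 q : (forall v, pol q v v = 0) -> q = 0.
Proof.
move=> q0; apply: heval_eq0 => v; have /eqP := q0 v.
by rewrite pol_diag mulrn_eq0 /= => /eqP.
Qed.

End QuadraticForms.

(** * Transvectants as quadrics, and quadratic equations for padded polynomials *)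

Section TransvectantForm.
Variables (F : numClosedFieldType) (W : vectType F) (n : nat).

Definition transv_form M (e w : W) (phi psi : {mpoly F[\dim {:W}]} -> F) :
    hpoly 2 (hpoly n W) :=
  \sum_(i < M.+1) ((-1) ^+ i * 'C(M, i)%:R) *:
    prodq (fun P : hpoly n W => phi (iter (M - i) (dirder e) (iter i (dirder w) P)))
          (fun P : hpoly n W => psi (iter i (dirder e) (iter (M - i) (dirder w) P))).

Lemma heval_transv_form M e w phi psi (P : hpoly n W) : scalar phi -> scalar psi ->
  heval (transv_form M e w phi psi) P =
  transv (dirder e) (dirder w) M phi psi (P : {mpoly F[_]}) P.
Proof.
move=> sphi spsi; rewrite transvE; last exact: dirderC.
rewrite /transv_form -[heval _ P]/(eval_at P _).
rewrite linear_sum /=; apply: eq_bigr => i _.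
rewrite [LHS]linearZ /= /eval_at heval_prodq ?mulrA //.
  by move=> a p q; rewrite !linearP sphi.
by move=> a p q; rewrite !linearP spsi.
Qed.

(** The equations are all quadrics of the ideal. They include the transvectants of order 2m + 1 for
    arbitrary phi and psi, and these force P to be padded. *)
Lemma padded_cut_out_by_quadrics m : (4 * m < n)%N ->
  cut_out_in_degree 2 (fun P : hpoly n W => padded m P).
Proof.
move=> lt4mn; exists (vanishing_forms (fun P : hpoly n W => padded m P)) => P.
split=> [padP q|vP]; first exact.
apply: (padded_of_transv lt4mn (erefl _)) => e w phi psi sphi spsi.
rewrite -heval_transv_form //; apply: vP => Q [l [h eQ]].
rewrite heval_transv_form // eQ; 
by apply: (transv_padded _ _ _ (dhomog_is_dhomog l) (dhomog_is_dhomog h)).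
Qed.

End TransvectantForm.

(** * Quadrics on pairs of linear forms *)

Section Beta.
Variables (F : numClosedFieldType) (W : vectType F) (n : nat).
Local Notation poly := {mpoly F[\dim {:W}]}.
Implicit Types (l mu p : poly) (q : hpoly 2 (hpoly n W)).

(** Taking the degree n component is linear on all polynomials, so sums and powers become points of
    [hpoly n W] without homogeneity proofs. *)
Definition prj (p : poly) : hpoly n W := DHomog (pihomogP mdeg n p).

Lemma prj_is_linear : linear prj.
Proof. by move=> a p q; apply: val_inj; rewrite /= linearP. Qed.
HB.instance Definition _ := GRing.isLinear.Build F poly (hpoly n W) _ prj prj_is_linear.

Lemma prjE p : p \is n.-homog -> (prj p : poly) = p.
Proof. exact: pihomog_dE. Qed.

Lemma prj_hpoly (P : hpoly n W) : prj P = P.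
Proof. by apply: val_inj; rewrite /= pihomog_dE // dhomog_is_dhomog. Qed.

Definition beta q l mu i j : F :=
  pol q (prj (l ^+ (n - i) * mu ^+ i)) (prj (l ^+ (n - j) * mu ^+ j)).

Lemma beta_sym q l mu i j : beta q l mu i j = beta q l mu j i.
Proof. exact: pol_sym. Qed.

(* The coefficient of t in beta q (l + t *: mu) mu i (k - i). *)
Lemma beta_shift q k : (forall l mu, l \is 1.-homog -> mu \is 1.-homog ->
    forall i, (i <= k <= n)%N -> beta q l mu i (k - i) = 0) ->
  forall l mu, l \is 1.-homog -> mu \is 1.-homog -> forall i, (i <= k < n)%N ->
  (n - i)%:R * beta q l mu i.+1 (k - i) +
  (n - k + i)%:R * beta q l mu i (k - i).+1 = 0.
Proof.
move=> b0 l mu hl hmu i /andP[leik ltkn].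
set j := (k - i)%N; pose a := (n - i)%N; pose b := (n - j)%N.
have -> : (n - k + i = b)%N by rewrite /b /j; lia.
pose c x y := pol q (prj (l ^+ (a - x) * mu ^+ (i + x)))
                    (prj (l ^+ (b - y) * mu ^+ (j + y))).
(* The value at l + t mu as a polynomial in t. The ranges run one past a and b, with zero binomials,
   so that index 1 can be split off without case analysis. *)
pose H := \sum_(x < a.+2) \sum_(y < b.+2)
   ('C(a, x)%:R * 'C(b, y)%:R * c x y) *: 'X^(x + y).
have expand d e t : (l + t *: mu) ^+ d * mu ^+ e =
    \sum_(x < d.+2) ('C(d, x)%:R * t ^+ x) *: (l ^+ (d - x) * mu ^+ (e + x)).
  rewrite big_ord_recr /= bin_small // mul0r scale0r addr0 exprDn mulr_suml.
  apply: eq_bigr => x _; rewrite exprZn -scalerAr -scaler_nat scalerA -scalerAl.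
  by rewrite addnC exprD mulrA.
have H0 : H = 0.
  apply: poly_eq0_everywhere => t.
  have hlt : l + t *: mu \is 1.-homog by rewrite rpredD // rpredZ.
  rewrite -[RHS](b0 _ _ hlt hmu i); last by rewrite leik ltnW.
  rewrite /beta -/j -/a -/b !expand.
  rewrite (linear_sum prj) pol_sym (linear_sum (pol q _)) /H horner_sum.
  apply: eq_bigr => x _ /=.
  rewrite pol_sym (linear_sum prj) (linear_sum (pol q _)) horner_sum /=.
  apply: eq_bigr => y _.
  rewrite hornerZ hornerXn !linearZ /= pol_sym linearZ /= pol_sym -/(c x y) exprD.
  ring.
have := congr1 (fun h : {poly F} => h`_1) H0; rewrite coef0 coef_sum.
rewrite big_ord_recl big_ord_recl /= [X in _ + (_ + X)]big1 => [|x _]; last first.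
  by rewrite coef_sum big1 // => y _; rewrite coefZ coefXn mulr0.
rewrite addr0 !coef_sum !big_ord_recl /= !coefZ !coefXn /= !big1 => [|y _|y _].
- rewrite !bin0 !bin1 !mulr0 !mulr1 !mul1r !addr0 add0r => e.
  by rewrite -[RHS]e addrC; congr (_ * _ + _ * _); rewrite /c /beta /bump
    ?subn0 !addn0 !addn1 subn1 /a /b -subnS.
- by rewrite coefZ coefXn mulr0.
by rewrite coefZ coefXn mulr0.
Qed.

(** Each step multiplies by -(n - k + i + 1)/(n - i); the factorials clear the denominators. *)
Lemma beta_ratio q l mu k : (k <= n)%N ->
    (forall i, (i < k)%N -> (n - i)%:R * beta q l mu i.+1 (k - i.+1) +
       (n - k + i.+1)%:R * beta q l mu i (k - i) = 0) ->
  forall i, (i <= k)%N -> (n`! * (n - k)`!)%:R * beta q l mu i (k - i) =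
    (-1) ^+ i * ((n - i)`! * (n - k + i)`!)%:R * beta q l mu 0 k.
Proof.
move=> lekn step; elim=> [|i IH] lik; first by rewrite expr0 mul1r !subn0 addn0.
have ni0 : (n - i)%:R != 0 :> F by rewrite pnatr_eq0 subn_eq0 -ltnNge; lia.
apply: (mulfI ni0); rewrite mulrCA.
have /eqP := step i lik; rewrite addr_eq0 => /eqP ->.
rewrite mulrN mulrCA (IH (ltnW lik)) exprS.
have -> : ((n - i)`! = (n - i) * (n - i.+1)`!)%N.
  by have -> : (n - i = (n - i.+1).+1)%N by lia.
have -> : ((n - k + i.+1)`! = (n - k + i.+1) * (n - k + i)`!)%N by rewrite addnS factS.
by rewrite !natrM; ring.
Qed.

(** Induction on k = i + j: the level below makes all b_(i, k-i) nonzero multiples of b_(0, k), so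
    one vanishing relation per level is enough. *)
Lemma beta_vanish q K : (K <= n)%N ->
    (forall s, (s.*2 <= K)%N ->
      (forall l mu, l \is 1.-homog -> mu \is 1.-homog -> beta q l mu s s = 0) \/
      (forall l mu, l \is 1.-homog -> mu \is 1.-homog ->
         \sum_(i < s.*2.+1) (-1) ^+ i * 'C(s.*2, i)%:R * beta q l mu i (s.*2 - i) = 0)) ->
  forall k, (k <= K)%N -> forall l mu, l \is 1.-homog -> mu \is 1.-homog ->
    forall i, (i <= k)%N -> beta q l mu i (k - i) = 0.
Proof.
move=> leKn hyp; elim=> [|k IH] lekK l mu hl hmu.
  move=> i; rewrite leqn0 => /eqP ->.
  have [H|H] := hyp 0%N isT; first exact: H.
  by have := H l mu hl hmu; rewrite big_ord1 bin0 expr0 !mul1r.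
have lekn : (k.+1 <= n)%N by lia.
have ratio := @beta_ratio q l mu k.+1 lekn _.
have {ratio} ratio i : (i <= k.+1)%N -> (n`! * (n - k.+1)`!)%:R * beta q l mu i (k.+1 - i) =
    (-1) ^+ i * ((n - i)`! * (n - k.+1 + i)`!)%:R * beta q l mu 0 k.+1.
  move=> leik; apply: ratio => // x ltxk; rewrite subSS subSn //.
  have -> : (n - k.+1 + x.+1 = n - k + x)%N by lia.
  apply: beta_shift => //; last by rewrite -ltnS ltxk.
  by move=> ? ? ? ? y /andP[leyk _]; apply: IH => //; lia.
have fact0 x y : (x`! * y`!)%:R != 0 :> F by rewrite pnatr_eq0 -lt0n muln_gt0 !fact_gt0.
suff b0 : beta q l mu 0 k.+1 = 0.
  move=> i lei; apply: (mulfI (fact0 n (n - k.+1)%N)).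
  by rewrite ratio // b0 !mulr0.
have [odd_k|even_k] := boolP (odd k.+1).
  (* In odd degree the two end values are opposite by the ratio and equal by symmetry. *)
  have := ratio k.+1 (leqnn _); rewrite subnn beta_sym -signr_odd odd_k expr1.
  rewrite subnK // mulN1r mulNr => /eqP; rewrite -addr_eq0 mulnC -mulr2n.
  by rewrite mulrn_eq0 mulf_eq0 (negPf (fact0 _ _)) /= => /eqP.
have ek : k.+1 = (k.+1)./2.*2 by rewrite -[LHS]odd_double_half (negPf even_k).
have := hyp (k.+1)./2; rewrite -ek => /(_ lekK) [H|/(_ _ _ hl hmu) H].
  have les : ((k.+1)./2 <= k.+1)%N by rewrite [X in (_ <= X)%N]ek -addnn leq_addr.
  have := ratio _ les; have -> : (k.+1 - (k.+1)./2 = (k.+1)./2)%N by lia.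
  rewrite H // mulr0 => /esym/eqP.
  by rewrite !mulf_eq0 signr_eq0 (negPf (fact0 _ _)) /= => /eqP.
(* The signs of the transvectant cancel those of the ratios: b_(0, 2s) is multiplied by a positive
   integer. *)
have := congr1 (fun x => (n`! * (n - k.+1)`!)%:R * x) H; rewrite mulr0 mulr_sumr.
rewrite (eq_bigr (fun i : 'I_k.+2 => ('C(k.+1, i) * ((n - i)`! * (n - k.+1 + i)`!))%:R *
    beta q l mu 0 k.+1)); last first.
  move=> i _; have leik : (i <= k.+1)%N by rewrite -ltnS.
  rewrite [LHS]mulrCA (ratio _ leik) [in RHS]natrM !mulrA; congr (_ * _ * _).
  by rewrite mulrAC -signr_odd -expr2 sqrr_sign mul1r.
rewrite -mulr_suml -natr_sum => /eqP; rewrite mulf_eq0 pnatr_eq0 big_ord_recl.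
by rewrite addn_eq0 !muln_eq0 !eqn0Ngt bin_gt0 !fact_gt0 andFb orFb => /eqP.
Qed.

End Beta.

(** * The contravariant inner product *)

Section InnerProduct.
Variables (F : numClosedFieldType) (W : vectType F) (n : nat).
Local Notation N := (\dim {:W}).
Local Notation poly := {mpoly F[N]}.
Local Notation quads := (hpoly 2 (hpoly n W)).
Local Notation words := {ffun 'I_n -> 'I_N}.
Local Notation prj := (@prj F W n).
Implicit Types (q : quads) (I J : words).

(** A monomial occurs once per ordering of its factors. In these redundant coordinates GL(W) acts by
    the n-th tensor power of its matrix, and no multinomial weights appear. *)
Definition word_mon I : poly := \prod_k 'X_(I k).

Lemma prod_linear_words (c : 'I_n -> 'I_N -> F) :
  \prod_k \sum_(j < N) c k j *: 'X_j = \sum_(I : words) (\prod_k c k (I k)) *: word_mon I.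
Proof.
by rewrite bigA_distr_bigA /=; apply: eq_bigr => I _; rewrite scaler_prod.
Qed.

Lemma word_mon_homog I : word_mon I \is n.-homog.
Proof.
have -> : word_mon I = 'X_[\sum_(k < n) U_(I k)].
  by rewrite (big_morph _ (@mpolyXD _ _) (@mpolyX0 _ _)).
rewrite dhomogX /= mdeg_sum; apply/eqP.
by rewrite (eq_bigr (fun=> 1%N)) => [|k _]; rewrite ?mdeg1 // sum1_card card_ord.
Qed.

Lemma mon_is_word (m : 'X_{1..N}) : mdeg m = n -> exists I, 'X_[m] = word_mon I.
Proof.
have H k (m' : 'X_{1..N}) : mdeg m' = k ->
    exists2 s : seq 'I_N, size s = k & 'X_[m'] = \prod_(i <- s) 'X_i :> poly.
  elim: k m' => [|k IH] m' hm.
    exists [::] => //; rewrite big_nil; move/eqP: hm; rewrite mdeg_eq0 => /eqP ->.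
    exact: mpolyX0.
  have [i mi] : exists i, m' i != 0%N.
    apply/existsP; apply: contraPT hm; rewrite negb_exists => /forallP m0.
    rewrite mdegE big1 // => i _; apply/eqP; by move: (m0 i); rewrite negbK.
  have lei : (U_(i) <= m')%MM by rewrite lep1mP.
  have [|s sz es] := IH (m' - U_(i))%MM.
    by have := mdegD (m' - U_(i)) U_(i); rewrite submK // hm mdeg1 addn1 => -[].
  exists (i :: s); first by rewrite /= sz.
  by rewrite big_cons -es -mpolyXD addmC submK.
move=> /H [s sz es]; have /eqP sz' := sz.
exists [ffun k => tnth (Tuple sz') k]; rewrite es /word_mon.
by under [RHS]eq_bigr do rewrite ffunE; rewrite (big_tuple _ _ (Tuple sz')).
Qed.

Lemma word_span (f : hpoly n W -> F) : scalar f ->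
  (forall I, f (prj (word_mon I)) = 0) -> forall P, f P = 0.
Proof.
move=> sf f0 P; rewrite -(prj_hpoly P).
pose lf : {scalar (hpoly n W)} := HB.pack f (GRing.isLinear.Build F _ F *%R f sf).
rewrite [(P : poly)]mpolyE -[f _]/(lf _) !linear_sum big_seq big1 // => m mP.
have [I ->] := mon_is_word (dhomog_mf (dhomog_is_dhomog P) mP).
by rewrite !linearZ /= f0 mulr0.
Qed.

(** Expanding l^n in words shows that the polynomial p with coefficients f(word) vanishes at every
    point, hence is 0. Applying f to its conjugate gives the sum of the |f(word)|^2. *)
Lemma power_span (f : hpoly n W -> F) : scalar f ->
  (forall l, l \is 1.-homog -> f (prj (l ^+ n)) = 0) -> forall P, f P = 0.
Proof.
move=> sf f0; apply: (word_span sf).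
pose lf : {scalar (hpoly n W)} := HB.pack f (GRing.isLinear.Build F _ F *%R f sf).
pose p : poly := \sum_(I : words) f (prj (word_mon I)) *: word_mon I.
have p0 : p = 0.
  apply: (@homog_eq0 _ _ n) => [|x].
    by apply: rpred_sum => I _; rewrite rpredZ // word_mon_homog.
  pose l : poly := \sum_(j < N) crd x j *: 'X_j.
  have hl : l \is 1.-homog.
    by apply: rpred_sum => j _; rewrite rpredZ // dhomogX; apply/eqP/mdeg1.
  rewrite -[RHS](f0 l hl) -[n in l ^+ n]card_ord -prodr_const prod_linear_words.
  rewrite /p (raddf_sum (meval _)) -[RHS]/(lf _) (linear_sum prj) linear_sum /=.
  apply: eq_bigr => I _.
  rewrite mevalZ linearZ -[RHS]/(lf _) [lf _]linearZ /= mulrC; congr (_ * _).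
  by rewrite /word_mon rmorph_prod; apply: eq_bigr => k _ /=; rewrite mevalXU.
have e : \sum_(I : words) (f (prj (word_mon I)))^* *: word_mon I = 0 :> poly.
  transitivity (map_mpoly (Num.conj : {rmorphism F -> F}) p); last by rewrite p0 rmorph0.
  rewrite /p (raddf_sum (map_mpoly _)); apply: eq_bigr => I _ /=.
  rewrite map_mpolyZ; congr (_ *: _).
  rewrite /word_mon (rmorph_prod (map_mpoly _)); apply: eq_bigr => k _.
  by rewrite /= map_mpolyX.
have := linear0 lf; rewrite -(linear0 prj) -e (linear_sum prj) linear_sum => /eqP.
rewrite (eq_bigr (fun I => `|f (prj (word_mon I))| ^+ 2)); last first.
  by move=> I _; rewrite linearZ [LHS]linearZ /= normCK mulrC.
rewrite psumr_eq0 => [/allP H I|I _]; last by rewrite exprn_ge0.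
by have := H I (mem_index_enum _); rewrite sqrf_eq0 normr_eq0 => /eqP.
Qed.

Lemma beta_eq0 q : (forall l mu, l \is 1.-homog -> mu \is 1.-homog ->
  beta q l mu 0 n = 0) -> q = 0.
Proof.
move=> b0; apply: pol_eq0 => P.
apply: (power_span (pol_scalarr q P)) => mu hmu; rewrite pol_sym.
move: P; apply: (power_span (pol_scalarr q _)) => l hl.
by have := b0 _ _ hmu hl; rewrite /beta subn0 subnn !expr0 mulr1 mul1r => ->.
Qed.

Definition qcoef q I J : F := pol q (prj (word_mon I)) (prj (word_mon J)).

Definition ip q q' : F := \sum_(I : words) \sum_(J : words) qcoef q I J * (qcoef q' I J)^*.

Lemma ip_is_scalar q' : scalar (ip^~ q').
Proof.
move=> a p q; rewrite /ip mulr_sumr -big_split /=; apply: eq_bigr => I _.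
rewrite mulr_sumr -big_split /=; apply: eq_bigr => J _.
by rewrite /qcoef -!/(pol_at _ _ _) linearP /= mulrDl mulrA.
Qed.

Lemma ip_conj q q' : ip q' q = (ip q q')^*.
Proof.
rewrite /ip rmorph_sum; apply: eq_bigr => I _; rewrite rmorph_sum.
by apply: eq_bigr => J _; rewrite rmorphM /= conjCK mulrC.
Qed.

Lemma ip_eq0 q : ip q q = 0 -> q = 0.
Proof.
move=> /eqP; rewrite /ip psumr_eq0 => [/allP H|I _]; last first.
  by apply: sumr_ge0 => J _; apply: mul_conjC_ge0.
apply: pol_eq0 => P.
apply: (word_span (pol_scalarr q P)) => J; rewrite pol_sym; move: P.
apply: (word_span (pol_scalarr q _)) => I; rewrite pol_sym.
have := H I (mem_index_enum _); rewrite psumr_eq0 => [/allP|J' _]; last exact: mul_conjC_ge0.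
by move=> /(_ J (mem_index_enum _)); rewrite mul_conjC_eq0 => /eqP.
Qed.

Lemma pol_sym_act (g : 'End(W)) q P Q :
  pol (sym_act 2 n g q) P Q = pol q (pullback g P) (pullback g Q).
Proof. by rewrite !pol_heval !heval_sym_act linearD. Qed.

Definition word_coef (g : 'End(W)) I J : F := \prod_k end_coef g (I k) (J k).

Lemma pullback_word (g : 'End(W)) I :
  pullback g (prj (word_mon I)) = \sum_(J : words) word_coef g I J *: prj (word_mon J).
Proof.
have -> : \sum_(J : words) word_coef g I J *: prj (word_mon J) =
    prj (\prod_k \sum_(j < N) end_coef g (I k) j *: 'X_j).
  by rewrite prod_linear_words linear_sum; apply: eq_bigr => J _; rewrite linearZ.
apply: val_inj; rewrite /= pihomog_dE ?word_mon_homog //.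
rewrite /word_mon rmorph_prod /= -[RHS]/(pihomog mdeg n _) pihomog_dE; last first.
  rewrite prod_linear_words; apply: rpred_sum => J _.
  by rewrite rpredZ ?word_mon_homog.
apply: eq_bigr => k _; rewrite comp_mpolyXU -tnth_nth tnth_mktuple //.
Qed.

Lemma qcoef_sym_act (g : 'End(W)) q I J :
  qcoef (sym_act 2 n g q) I J =
  \sum_(I' : words) \sum_(J' : words) word_coef g I I' * word_coef g J J' * qcoef q I' J'.
Proof.
rewrite /qcoef pol_sym_act !pullback_word pol_sym linear_sum; apply: eq_bigr => I' _.
rewrite linearZ /= pol_sym linear_sum mulr_sumr; apply: eq_bigr => J' _.
by rewrite linearZ /= mulrA.
Qed.

(** Tensor powers commute with the conjugate transpose. *)
Lemma ip_adjoint (g h : 'End(W)) q q' :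
    (forall i j, end_coef h i j = (end_coef g j i)^*) ->
  ip (sym_act 2 n g q) q' = ip q (sym_act 2 n h q').
Proof.
move=> gh; have ghw I J : word_coef h I J = (word_coef g J I)^*.
  by rewrite /word_coef rmorph_prod; apply: eq_bigr => k _; rewrite gh.
rewrite /ip.
transitivity (\sum_(I : words) \sum_(J : words) \sum_(I' : words) \sum_J'
    word_coef g I I' * word_coef g J J' * qcoef q I' J' * (qcoef q' I J)^*).
  apply: eq_bigr => I _; apply: eq_bigr => J _; rewrite qcoef_sym_act mulr_suml.
  by apply: eq_bigr => I' _; rewrite mulr_suml.
under eq_bigr => I _ do rewrite exchange_big /=.
rewrite exchange_big /=; apply: eq_bigr => I' _.
under eq_bigr => I _ do rewrite exchange_big /=.
rewrite exchange_big /=; apply: eq_bigr => J' _.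
rewrite qcoef_sym_act rmorph_sum mulr_sumr; apply: eq_bigr => I _.
rewrite rmorph_sum mulr_sumr; apply: eq_bigr => J _.
by rewrite !rmorphM /= !ghw !conjCK; ring.
Qed.

End InnerProduct.

(** * Highest weight quadrics *)

(** For possibly infinite families: a finite subfamily with span of maximal dimension absorbs every
    further vector. *)
Lemma exists_span (F : fieldType) (V : vectType F) (T : Type) (f : T -> V) :
  exists U : {vspace V}, (forall t, f t \in U) /\
    forall U' : {vspace V}, (forall t, f t \in U') -> (U <= U')%VS.
Proof.
pose P k := `[< exists s : seq T, \dim <<map f s>> = k >].
have P0 : exists k, P k by exists (\dim <<map f [::]>>); apply/asboolP; exists [::].
have Pmax k : P k -> (k <= \dim {:V})%N.
  by move=> /asboolP [s <-]; apply/dimvS/subvf.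
case: (ex_maxnP P0 Pmax) => k /asboolP [s ek] maxk.
exists <<map f s>>%VS; split=> [t|U' fU']; last first.
  by elim: s {ek} => [|t s IH]; rewrite ?span_nil ?sub0v //= span_cons subv_add IH andbT -memvE.
have sub : (<<map f s>> <= <<map f (t :: s)>>)%VS.
  by rewrite /= span_cons addvSr.
have le : (\dim <<map f (t :: s)>> <= k)%N.
  by apply: maxk; apply/asboolP; exists (t :: s).
have /eqP -> : <<map f s>>%VS == <<map f (t :: s)>>%VS by rewrite eqEdim sub ek.
by rewrite /= memv_span ?mem_head.
Qed.

Section HighestWeightForms.
Variables (F : numClosedFieldType) (W : vectType F) (n : nat).
Local Notation N := (\dim {:W}).
Local Notation poly := {mpoly F[N]}.
Local Notation quads := (hpoly 2 (hpoly n W)).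
Local Notation words := {ffun 'I_n -> 'I_N}.
Local Notation prj := (@prj F W n).
Implicit Types (q : quads) (I J : words) (e w : W).

(** The transvectant (P, P)_(2s) along (e, w), with the remaining n - 2s derivatives of each factor
    taken along e. At the first two basis vectors it is the highest weight vector. *)
Definition hwform s e w : quads :=
  let phi p := (iter (n - s.*2) (dirder e) p)@_0%MM in
  transv_form n s.*2 e w phi phi.

Lemma hwformE s e w : (s.*2 <= n)%N -> hwform s e w =
  \sum_(i < s.*2.+1) ((-1) ^+ i * 'C(s.*2, i)%:R) *:
    prodq (fun P : hpoly n W => polar_coef n e w i P)
          (fun P : hpoly n W => polar_coef n e w (s.*2 - i) P).
Proof.
move=> lesn; apply: eq_bigr => i _; have lti : (i < s.*2.+1)%N := ltn_ord i.
congr (_ *: prodq _ _); apply: funext => P; rewrite /polar_coef -iterD;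
  congr ((iter _ _ _)@__); lia.
Qed.

Lemma polar_coef_hpoly_scalar e w i : scalar (fun P : hpoly n W => polar_coef n e w i P).
Proof. by move=> a P Q; rewrite polar_coef_is_scalar. Qed.

Lemma heval_hwform s e w (P : hpoly n W) : (s.*2 <= n)%N -> heval (hwform s e w) P =
  \sum_(i < s.*2.+1) (-1) ^+ i * 'C(s.*2, i)%:R *
    polar_coef n e w i P * polar_coef n e w (s.*2 - i) P.
Proof.
move=> lesn; rewrite hwformE // -[LHS]/(eval_at P _) linear_sum.
apply: eq_bigr => i _; rewrite linearZ /= /eval_at heval_prodq ?mulrA //;
  exact: polar_coef_hpoly_scalar.
Qed.

Lemma pol_hwform s e w (P Q : hpoly n W) : (s.*2 <= n)%N -> pol (hwform s e w) P Q =
  \sum_(i < s.*2.+1) (-1) ^+ i * 'C(s.*2, i)%:R *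
    (polar_coef n e w i P * polar_coef n e w (s.*2 - i) Q +
     polar_coef n e w i Q * polar_coef n e w (s.*2 - i) P).
Proof.
move=> lesn; rewrite hwformE // -[LHS]/(pol_at P Q _) linear_sum.
apply: eq_bigr => i _; rewrite linearZ /= /pol_at pol_prodq //;
  exact: polar_coef_hpoly_scalar.
Qed.

Lemma hwform_padded m s e w : (m < s)%N ->
  vanishing_forms (fun P : hpoly n W => padded m P) (hwform s e w).
Proof.
move=> ltms P [l [h eP]].
have sphi : scalar (fun p : poly => (iter (n - s.*2) (dirder e) p)@_0%MM).
  by move=> a p q; rewrite !linearP.
rewrite heval_transv_form // eP.
apply: (transv_padded _ _ _ (dhomog_is_dhomog l) (dhomog_is_dhomog h)) => //.
by rewrite ltn_double.
Qed.

Lemma hwform_shear s e w c : hwform s e (w + c *: e) = hwform s e w.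
Proof.
apply/eqP; rewrite -subr_eq0; apply/eqP; apply: heval_eq0 => P.
have sphi : scalar (fun p : poly => (iter (n - s.*2) (dirder e) p)@_0%MM).
  by move=> a p q; rewrite !linearP.
rewrite -[LHS]/(eval_at P _) linearB /= /eval_at !heval_transv_form //.
have -> : dirder (w + c *: e) = (fun p => dirder w p + c *: dirder e p).
  by apply: funext => p; rewrite -[w]scale1r dirder_lincomb !scale1r.
by rewrite transv_shear ?subrr //; exact: dirder_is_linear.
Qed.

(** A shear reduces w = c e to w = 0; as 2s > 0, each term then contains a derivative along 0. *)
Lemma hwform_collinear s e w : (0 < s)%N -> e = 0 \/ w \in <[e]>%VS ->
  hwform s e w = 0.
Proof.
move=> s_gt0 ew; apply: heval_eq0 => P.
have sphi e' : scalar (fun p : poly => (iter (n - s.*2) (dirder e') p)@_0%MM).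
  by move=> a p q; rewrite !linearP.
have iter0 k (p : poly) : (0 < k)%N -> iter k (dirder (0 : W)) p = 0.
  by case: k => // k _; rewrite iterS dirder0.
have s2 : (0 < s.*2)%N by rewrite double_gt0.
case: ew => [->|/vlineP [c ->]].
  rewrite heval_transv_form // transvE; last exact: dirderC.
  rewrite big1 // => i _; case: (posnP i) => [->|i_gt0].
    by rewrite subn0 (iter0 s.*2) // !linear0 mulr0 mul0r.
  by rewrite (iter0 i) // !linear0 mulr0.
rewrite -[c *: e]add0r hwform_shear heval_transv_form // transvE; last exact: dirderC.
rewrite big1 // => i _; case: (posnP i) => [->|i_gt0].
  by rewrite subn0 (iter0 s.*2) // !linear0 mulr0.
by rewrite (iter0 i) // !linear0 mulr0 mul0r.
Qed.

(** P o g on the line e + t w is P on the line g e + t g w, so the polarization coefficients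
    agree. *)
Lemma sym_act_hwform s e w (g : 'End(W)) : (s.*2 <= n)%N ->
  sym_act 2 n g (hwform s e w) = hwform s (g e) (g w).
Proof.
move=> lesn; apply/eqP; rewrite -subr_eq0; apply/eqP; apply: heval_eq0 => P.
rewrite -[LHS]/(eval_at P _) linearB /= /eval_at heval_sym_act !heval_hwform //.
have pc i : (i <= n)%N -> polar_coef n e w i (pullback g P : {mpoly F[_]}) =
    polar_coef n (g e) (g w) i P.
  apply: polar_coef_inj; try exact: dhomog_is_dhomog.
  by move=> t; rewrite -!heval_crd heval_pullback linearD linearZ.
apply/eqP; rewrite subr_eq0; apply/eqP; apply: eq_bigr => i _.
by have lti : (i < s.*2.+1)%N := ltn_ord i; rewrite !pc //; lia.
Qed.

Lemma hwform_scale s e w a b : (s.*2 <= n)%N ->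
  hwform s (a *: e) (b *: w) = (a ^+ (2 * (n - s)) * b ^+ (2 * s)) *: hwform s e w.
Proof.
move=> lesn; apply/eqP; rewrite -subr_eq0; apply/eqP; apply: heval_eq0 => P.
rewrite -[LHS]/(eval_at P _) linearB linearZ /= /eval_at !heval_hwform //.
have iterZ c (v : W) k (p : poly) : iter k (dirder (c *: v)) p = c ^+ k *: iter k (dirder v) p.
  elim: k => [|k IH]; first by rewrite scale1r.
  rewrite !iterS IH linearZ /= exprSr -scalerA; congr (_ *: _).
  by have := dirder_lincomb c 0 v 0 (iter k (dirder v) p); rewrite !scale0r !addr0.
have pc i (p : poly) : polar_coef n (a *: e) (b *: w) i p =
    a ^+ (n - i) * b ^+ i * polar_coef n e w i p.
  by rewrite /polar_coef !iterZ !linearZ /= mulrA.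
apply/eqP; rewrite subr_eq0; apply/eqP; rewrite mulr_sumr.
apply: eq_bigr => i _; have lti : (i < s.*2.+1)%N := ltn_ord i.
rewrite !pc.
have -> : (2 * (n - s) = (n - i) + (n - (s.*2 - i)))%N by lia.
have -> : (2 * s = i + (s.*2 - i))%N by lia.
by rewrite !exprD; ring.
Qed.

Definition conj_form e : poly := \sum_(j < N) (crd e j)^* *: 'X_j.

Lemma conj_form_homog e : conj_form e \is 1.-homog.
Proof.
by apply: rpred_sum => j _; rewrite rpredZ // dhomogX; apply/eqP/mdeg1.
Qed.

Lemma conj_form_surj l : l \is 1.-homog -> exists e, conj_form e = l.
Proof.
move=> hl; exists (\sum_(j < N) (l@_U_(j))^* *: (vbasis {:W})`_j).
have -> : l = linform (fun v => l.@[crd v]).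
  apply/eqP; rewrite -subr_eq0; apply/eqP; apply: (@homog_eq0 _ _ 1) => [|x].
    by rewrite rpredB // linform_homog.
  rewrite mevalB linform_eval ?subrr // => a u v.
  have lin (z : W) : l.@[crd z] = (dirder z l)@_0%MM.
    by rewrite dirder_linear_form // mcoeffC eqxx mulr1.
  by rewrite !lin -[v]scale1r dirder_lincomb !scale1r mcoeffD mcoeffZ.
rewrite /conj_form /linform; apply: eq_bigr => j _; congr (_ *: _).
rewrite /crd coord_sum_free ?(basis_free (vbasisP _)) // conjCK.
rewrite linear_sum /= (bigD1 j) //= big1 => [|k kj].
  by rewrite mcoeffZ mcoeffXU eqxx mulr1 addr0.
by rewrite mcoeffZ mcoeffXU (negPf kj) mulr0.
Qed.

(** The Riesz vector of [polar_coef] in word coordinates. Both sides come from the n-th power of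
    [conj_form e + t *: conj_form w], expanded in words and by the binomial formula. *)
Lemma conj_polar_coef e w i : (i <= n)%N ->
  \sum_(I : words) (polar_coef n e w i (word_mon I))^* *: word_mon I =
  n`!%:R *: (conj_form e ^+ (n - i) * conj_form w ^+ i).
Proof.
move=> lein.
pose S k := \sum_(I : words) (polar_coef n e w k (word_mon I))^* *: word_mon I.
pose T k := n`!%:R *: (conj_form e ^+ (n - k) * conj_form w ^+ k).
have ST t : \sum_(k < n.+1) (t ^+ k *+ 'C(n, k)) *: S k =
            \sum_(k < n.+1) (t ^+ k *+ 'C(n, k)) *: T k.
  transitivity (n`!%:R *: (conj_form e + t *: conj_form w) ^+ n); last first.
    rewrite exprDn scaler_sumr; apply: eq_bigr => k _.
    rewrite exprZn -scalerAr -scaler_nat !scalerA.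
    by congr (_ *: _); rewrite -[_ *+ _]mulr_natl; ring.
  (* The point uses the conjugate of t, which the outer conjugation turns back into t. *)
  transitivity (\sum_(I : words)
      (n`!%:R * (word_mon I).@[crd (1 *: e + t^* *: w)])^* *: word_mon I).
    under eq_bigr => k _ do rewrite scaler_sumr.
    rewrite exchange_big /=; apply: eq_bigr => I _.
    rewrite eval_lincomb ?word_mon_homog // rmorph_sum scaler_suml /=.
    apply: eq_bigr => k _; rewrite scalerA; congr (_ *: _).
    by rewrite expr1n mul1r rmorphM /= rmorphMn rmorphXn /= conjCK.
  have -> : conj_form e + t *: conj_form w =
      \sum_(j < N) (crd (1 *: e + t^* *: w) j)^* *: 'X_j.
    rewrite /conj_form scaler_sumr -big_split /=; apply: eq_bigr => j _.
    rewrite /crd linearD !linearZ /= mul1r rmorphD rmorphM /= conjCK.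
    by rewrite scalerDl scalerA mulrC.
  rewrite -[n in RHS]card_ord -prodr_const.
  rewrite (prod_linear_words (fun=> fun j => (crd (1 *: e + t^* *: w) j)^*)).
  rewrite scaler_sumr; apply: eq_bigr => I _; rewrite scalerA; congr (_ *: _).
  rewrite rmorphM /= conjC_nat card_ord; congr (_ * _).
  rewrite /word_mon !rmorph_prod; apply: eq_bigr => k _ /=.
  by rewrite mevalXU.
rewrite -/(S i) -/(T i); apply/mpolyP => m.
pose H := \poly_(k < n.+1) (((S k)@_m - (T k)@_m) *+ 'C(n, k)).
have H0 : H = 0.
  apply: poly_eq0_everywhere => t; rewrite horner_poly.
  have := congr1 (mcoeff m) (ST t); rewrite !linear_sum /= => /eqP.
  rewrite -subr_eq0 -sumrB => /eqP {2}<-; apply: eq_bigr => k _.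
  by rewrite !mcoeffZ -mulrBr !mulrnAl mulrC.
have := congr1 (fun h : {poly F} => h`_i) H0; rewrite coef_poly ltnS lein coef0.
by move/eqP; rewrite mulrn_eq0 eqn0Ngt bin_gt0 lein /= subr_eq0 => /eqP.
Qed.

(** By [conj_polar_coef] the sums over words become values of [beta]; the two products in
    [pol_hwform] contribute equally, whence the factor 2. *)
Lemma ip_hwform q s e w : (s.*2 <= n)%N -> ip q (hwform s e w) =
  (n`!%:R ^+ 2 *+ 2) * \sum_(i < s.*2.+1) (-1) ^+ i * 'C(s.*2, i)%:R *
    beta q (conj_form e) (conj_form w) i (s.*2 - i).
Proof.
move=> lesn.
pose f i I := (polar_coef n e w i (word_mon I))^*.
have bf i j : (i <= n)%N -> (j <= n)%N ->
    \sum_(I : words) \sum_(J : words) qcoef q I J * (f i I * f j J) =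
    n`!%:R ^+ 2 * beta q (conj_form e) (conj_form w) i j.
  move=> lei lej.
  have -> : n`!%:R ^+ 2 * beta q (conj_form e) (conj_form w) i j =
      pol q (prj (\sum_(I : words) f i I *: word_mon I))
            (prj (\sum_(I : words) f j I *: word_mon I)).
    rewrite !conj_polar_coef // !linearZ /= pol_sym linearZ /= pol_sym.
    by rewrite mulrA -expr2.
  rewrite (linear_sum prj) pol_sym linear_sum; apply: eq_bigr => I _.
  rewrite (linear_sum prj) /= pol_sym linear_sum; apply: eq_bigr => J _.
  rewrite !linearZ /= pol_sym linearZ /= pol_sym /qcoef; ring.
rewrite /ip.
transitivity (\sum_(i < s.*2.+1) (-1) ^+ i * 'C(s.*2, i)%:R *
   (\sum_(I : words) \sum_(J : words) qcoef q I J * (f i I * f (s.*2 - i)%N J) +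
    \sum_(I : words) \sum_(J : words) qcoef q I J * (f (s.*2 - i)%N I * f i J))).
  under [RHS]eq_bigr => i _ do rewrite -big_split mulr_sumr /=.
  rewrite [RHS]exchange_big; apply: eq_bigr => I _ /=.
  under [RHS]eq_bigr => i _ do rewrite -big_split mulr_sumr /=.
  rewrite [RHS]exchange_big; apply: eq_bigr => J _ /=.
  rewrite {2}/qcoef pol_hwform // rmorph_sum mulr_sumr; apply: eq_bigr => i _ /=.
  rewrite !pihomog_dE ?word_mon_homog // !(rmorphM, rmorphD) /= rmorphXn /= rmorphN rmorph1.
  by rewrite conjC_nat /f; ring.
rewrite mulr_sumr; apply: eq_bigr => i _; have lti : (i < s.*2.+1)%N := ltn_ord i.
rewrite !bf; try lia.
by rewrite [beta _ _ _ (_ - _)%N _]beta_sym -mulr_natl; ring.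
Qed.

(** For i <= m the points l^(n-i) mu^i lie in the linear space of multiples of l^(n-m), on which q
    and hence its polarization vanish. *)
Lemma padded_beta m q : (m < n)%N ->
    vanishing_forms (fun P : hpoly n W => padded m P) q ->
  forall l mu, l \is 1.-homog -> mu \is 1.-homog ->
  forall i j, (i <= m)%N -> (j <= m)%N -> beta q l mu i j = 0.
Proof.
move=> ltmn vq l mu hl hmu i j leim lejm.
have hh k : (k <= m)%N -> l ^+ (m - k) * mu ^+ k \is m.-homog.
  move=> lekm; have := dhomogM (dhomogMn (m - k) hl) (dhomogMn k hmu).
  by rewrite !mul1n subnK.
have eP k : (k <= m)%N -> l ^+ (n - k) * mu ^+ k = l ^+ (n - m) * (l ^+ (m - k) * mu ^+ k).
  by move=> lekm; rewrite mulrA -exprD; congr (_ ^+ _ * _); lia.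
have hn h : h \is m.-homog -> l ^+ (n - m) * h \is n.-homog.
  move=> hm; have := dhomogM (dhomogMn (n - m) hl) hm.
  by rewrite mul1n subnK // ltnW.
have van h : h \is m.-homog -> heval q (prj (l ^+ (n - m) * h)) = 0.
  move=> hm; apply: vq; exists (DHomog hl), (DHomog hm).
  by rewrite prjE ?hn.
rewrite /beta !eP // pol_heval -linearD -mulrDr !van ?subr0 ?hh //.
by rewrite rpredD ?hh.
Qed.

(** Up to level 2s the diagonal values b_(s', s') with s' <= s suffice, and they vanish on the
    ideal. This yields the orthogonality of different orders. *)
Lemma padded_orth s q e w : (s.*2 <= n)%N -> (s < n)%N ->
  vanishing_forms (fun P : hpoly n W => padded s P) q -> ip q (hwform s e w) = 0.
Proof.
move=> lesn ltsn vq; rewrite ip_hwform // big1 ?mulr0 // => i _.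
rewrite (@beta_vanish _ _ _ q s.*2) ?mulr0 ?conj_form_homog //; last by rewrite -ltnS.
move=> s' les'; left=> l mu hl hmu; apply: (padded_beta ltsn) => //.
  by rewrite -leq_double.
by rewrite -leq_double.
Qed.

(** Even levels up to 2m are settled by the ideal, higher ones by orthogonality; level n gives b_(0,
    n) = 0. *)
Lemma padded_orth_eq0 m q : (m < n)%N ->
    vanishing_forms (fun P : hpoly n W => padded m P) q ->
    (forall s e w, (m < s)%N -> (s.*2 <= n)%N -> ip q (hwform s e w) = 0) ->
  q = 0.
Proof.
move=> ltmn vq orth; apply: beta_eq0 => l mu hl hmu.
rewrite -[X in beta _ _ _ _ X]subn0.
apply: (@beta_vanish _ _ _ q n) => // s lesn.
have [lesm|ltms] := leqP s m; [left|right] => l' mu' hl' hmu'.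
  exact: (padded_beta ltmn).
have [e <-] := conj_form_surj hl'; have [w <-] := conj_form_surj hmu'.
have /eqP := orth s e w ltms lesn; rewrite ip_hwform // mulf_eq0 mulrn_eq0 /=.
by rewrite expf_eq0 /= pnatr_eq0 eqn0Ngt fact_gt0 /= => /eqP.
Qed.

End HighestWeightForms.

(** * Orthogonal complements and endomorphisms *)

Section Orthogonality.
Variables (F : numClosedFieldType) (W : vectType F) (n : nat).
Local Notation quads := (hpoly 2 (hpoly n W)).
Implicit Types (q : quads) (U : {vspace quads}).

Definition ipr q' q : F := ip q q'.

HB.instance Definition _ q' :=
  GRing.isLinear.Build F quads F *%R (ipr q') (ip_is_scalar q').

Lemma ip0l q : ip 0 q = 0. Proof. exact: (linear0 (ipr q)). Qed.

Lemma ip0r q : ip q 0 = 0. Proof. by rewrite ip_conj ip0l conjC0. Qed.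

Lemma ipDl p q u : ip (p + q) u = ip p u + ip q u.
Proof. exact: (linearD (ipr u)). Qed.

Lemma ipBl p q u : ip (p - q) u = ip p u - ip q u.
Proof. exact: (linearB (ipr u)). Qed.

Lemma ipZl a q u : ip (a *: q) u = a * ip q u.
Proof. exact: (linearZ_LR (ipr u)). Qed.

Lemma ip_swap0 q q' : ip q q' = 0 -> ip q' q = 0.
Proof. by move=> e; rewrite ip_conj e conjC0. Qed.

Definition orthv q : {vspace quads} :=
  lker (linfun (ipr q : quads -> F^o)).

Lemma mem_orthv q q' : (q' \in orthv q) = (ip q' q == 0).
Proof. by rewrite memv_ker lfunE. Qed.

(** Gram-Schmidt along a basis of U. *)
Lemma orth_decomp U q : exists q1 q2,
  [/\ q = q1 + q2, q1 \in U & forall u, u \in U -> ip q2 u = 0].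
Proof.
rewrite -(span_basis (vbasisP U)); elim: (tval (vbasis U)) q => [|x X IH] q.
  exists 0, q; rewrite add0r mem0v; split=> // u.
  by rewrite span_nil memv0 => /eqP ->; rewrite ip0r.
have [x1 [x2 [ex X1 X2]]] := IH x; have [q1 [q2 [eq Q1 Q2]]] := IH q.
have inX y : y \in <<X>>%VS -> y \in <<x :: X>>%VS.
  by apply: (subvP _); rewrite span_cons addvSr.
have x2in : x2 \in <<x :: X>>%VS.
  have -> : x2 = x - x1 by rewrite ex addrC addKr.
  by apply: rpredB; [apply/memv_span/mem_head | apply: inX].
(* A zero denominator means x2 = 0, a case treated in [Hx2]. *)
pose c := ip q2 x2 / ip x2 x2.
exists (q1 + c *: x2), (q2 - c *: x2); split.
- by rewrite addrACA subrr addr0.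
- by apply: rpredD; [apply: inX | apply: rpredZ].
move=> u; rewrite span_cons => /memv_addP [y /vlineP [a ->] [z Zin ->]].
have H y' : y' \in <<X>>%VS -> ip (q2 - c *: x2) y' = 0.
  by move=> yin; rewrite ipBl ipZl Q2 // X2 // mulr0 subrr.
have Hx2 : ip (q2 - c *: x2) x2 = 0.
  rewrite ipBl ipZl /c; have [x20|x20] := eqVneq (ip x2 x2) 0.
    by rewrite x20 mulr0 subr0 (ip_eq0 x20) ip0r.
  by rewrite divfK // subrr.
apply: ip_swap0; rewrite ipDl ipZl {1}ex ipDl.
by rewrite (ip_swap0 (H _ Zin)) (ip_swap0 (H _ X1)) (ip_swap0 Hx2) !addr0 mulr0.
Qed.

End Orthogonality.

(** * Matrices, adjoints, and transitivity of GL(W) on independent pairs *)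

Section Endomorphisms.
Variables (F : numClosedFieldType) (W : vectType F).
Local Notation N := (\dim {:W}).

Definition mxend_fun (A : 'I_N -> 'I_N -> F) (v : W) : W :=
  \sum_(i < N) (\sum_(j < N) A i j * crd v j) *: (vbasis {:W})`_i.

Lemma mxend_is_linear A : linear (mxend_fun A).
Proof.
move=> a u v; rewrite /mxend_fun scaler_sumr -big_split; apply: eq_bigr => i _ /=.
rewrite scalerA -scalerDl mulr_sumr -big_split; congr (_ *: _).
by apply: eq_bigr => j _ /=; rewrite /crd linearP mulrDr mulrCA.
Qed.
HB.instance Definition _ A :=
  GRing.isLinear.Build F W W _ (mxend_fun A) (mxend_is_linear A).

Definition mxend A : 'End(W) := linfun (mxend_fun A).

Lemma crd_mxend A v i : crd (mxend A v) i = \sum_(j < N) A i j * crd v j.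
Proof. by rewrite lfunE /= /crd coord_sum_free ?(basis_free (vbasisP _)). Qed.

Lemma end_coef_mxend A i j : end_coef (mxend A) i j = A i j.
Proof.
rewrite /end_coef -/(crd _ i) crd_mxend (bigD1 j) //= big1 => [|k kj].
  by rewrite crd_vbasis eqxx mulr1 addr0.
by rewrite crd_vbasis eq_sym (negPf kj) mulr0.
Qed.

Lemma crd_end (g : 'End(W)) v i : crd (g v) i = \sum_(j < N) end_coef g i j * crd v j.
Proof.
rewrite {1}(coord_vbasis (memvf v)) linear_sum /crd linear_sum /=.
by apply: eq_bigr => j _; rewrite !linearZ /= mulrC.
Qed.

Lemma crd_inj (u v : W) : (forall i, crd u i = crd v i) -> u = v.
Proof.
move=> uv; rewrite (coord_vbasis (memvf u)) (coord_vbasis (memvf v)).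
by apply: eq_bigr => i _; have := uv i; rewrite /crd => ->.
Qed.

Lemma invertible_endP (g : 'End(W)) : (forall v, g v = 0 -> v = 0) -> invertible_end g.
Proof.
move=> g0; rewrite /invertible_end -subv0; apply/subvP => v.
by rewrite memv_ker memv0 => /eqP/g0/eqP.
Qed.

Lemma invertible_adjoint (g : 'End(W)) : invertible_end g ->
  exists2 h : 'End(W), invertible_end h &
    forall i j, end_coef h i j = (end_coef g j i)^*.
Proof.
move=> ginv; exists (mxend (fun i j => (end_coef g j i)^*)) => [|i j]; last first.
  exact: end_coef_mxend.
apply: invertible_endP => v hv0.
have : \sum_(j < N) crd v j * (crd v j)^* = 0.
  (* With v = g u and h the adjoint: <v, v> = <v, g u> = <h v, u> = 0. *)
  have ev := lker0_lfunVK ginv v; rewrite -{2}ev.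
  under eq_bigr => j _ do rewrite crd_end rmorph_sum mulr_sumr /=.
  rewrite exchange_big big1 // => i _ /=.
  have := congr1 (fun w => crd w i) hv0; rewrite crd_mxend /crd linear0 => e.
  transitivity ((crd ((g^-1)%VF v) i)^* * 0); last by rewrite mulr0.
  rewrite -[X in _ * X]e mulr_sumr; apply: eq_bigr => j _.
  by rewrite rmorphM /=; ring.
move/eqP; rewrite psumr_eq0 => [/allP H|j _]; last exact: mul_conjC_ge0.
apply: crd_inj => i; rewrite /crd linear0.
by have := H i (mem_index_enum _); rewrite mul_conjC_eq0 => /eqP.
Qed.

Lemma exists_end2 (i0 i1 : 'I_N) (e w : W) : (i0 : nat) = 0%N -> (i1 : nat) = 1%N ->
    ~ (e = 0 \/ w \in <[e]>%VS) ->
  exists2 g : 'End(W), invertible_end g &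
    g (vbasis {:W})`_i0 = e /\ g (vbasis {:W})`_i1 = w.
Proof.
move=> h0 h1 indep.
have fr : free [:: w; e].
  rewrite free_cons span_seq1 seq1_free; apply/andP; split; apply/negP => H.
    by apply: indep; right.
  by apply: indep; left; apply/eqP.
pose X := [:: e; w]; have frX : free X.
  by rewrite (@perm_free _ _ _ [:: w; e]) // (perm_catC [:: e] [:: w]).
pose B := X ++ vbasis (<<X>>^C)%VS.
have frB : free B.
  rewrite cat_free frX (basis_free (vbasisP _)) /=.
  by apply/directv_addP; rewrite (span_basis (vbasisP _)) capv_compl.
have szB : size B == N.
  rewrite size_cat (size_tuple (vbasis _)).
  have := dimv_compl <<X>>; have /eqP := frX; rewrite /= => eX eC.
  by rewrite eC eX subnKC // -[2%N]eX dimvS // subvf.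
pose g := mxend (fun i j => crd B`_j i).
have gE v : g v = \sum_(j < N) crd v j *: B`_j.
  apply: crd_inj => i; rewrite crd_mxend [in RHS]/crd linear_sum /=.
  by apply: eq_bigr => j _; rewrite linearZ /= mulrC.
have gb (j : 'I_N) : g (vbasis {:W})`_j = B`_j.
  rewrite gE (bigD1 j) //= big1 => [|k kj]; first by rewrite crd_vbasis eqxx scale1r addr0.
  by rewrite crd_vbasis eq_sym (negPf kj) scale0r.
exists g; last by rewrite !gb h0 h1.
apply: invertible_endP => v; rewrite gE => gv0.
have /freeP := (frB : free (Tuple szB)); move=> /(_ (crd v) gv0) v0.
by apply: crd_inj => i; rewrite v0 /crd linear0.
Qed.

End Endomorphisms.

(** * Uniqueness of highest weight vectors *)

Section HighestWeight.
Variables (F : numClosedFieldType) (W : vectType F) (n : nat).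
Local Notation N := (\dim {:W}).
Local Notation poly := {mpoly F[N]}.
Local Notation quads := (hpoly 2 (hpoly n W)).
Local Notation prj := (@prj F W n).
Local Notation rho := (@sym_act F W 2 n).
Implicit Types (q u : quads).
Variables (i0 i1 : 'I_N).
Hypotheses (val_i0 : i0 = 0%N :> nat) (val_i1 : i1 = 1%N :> nat).

Definition lin (c : 'I_N -> F) : poly := \sum_(j < N) c j *: 'X_j.

Lemma lin_homog c : lin c \is 1.-homog.
Proof. by apply: rpred_sum => j _; rewrite rpredZ // dhomogX; apply/eqP/mdeg1. Qed.

Lemma pullback_power (g : 'End(W)) (c : 'I_N -> F) :
  pullback g (prj (lin c ^+ n)) =
  prj (lin (fun j => \sum_(i < N) c i * end_coef g i j) ^+ n).
Proof.
have hl (c' : 'I_N -> F) : lin c' ^+ n \is n.-homog.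
  by have := dhomogMn n (lin_homog c'); rewrite mul1n.
apply: val_inj; rewrite /= !pihomog_dE // rmorphXn /=; congr (_ ^+ n).
rewrite /lin (raddf_sum (comp_mpoly _)) /=.
under [RHS]eq_bigr do rewrite scaler_suml.
rewrite [RHS]exchange_big /=; apply: eq_bigr => i _.
rewrite comp_mpolyZ comp_mpolyXU -tnth_nth tnth_mktuple scaler_sumr.
by apply: eq_bigr => j _; rewrite scalerA.
Qed.

Definition weight_vector (chi : 'End(W) -> F) u :=
  forall g, invertible_end g -> upper_triangular g -> rho g u = chi g *: u.

(** The Borel subgroup has an open orbit on pairs of linear forms up to scalars, through (x_0, x_0 +
    x_1); the value there determines a weight vector. *)
Definition top_coef u : F :=
  pol u (prj ('X_i0 ^+ n)) (prj (('X_i0 + 'X_i1) ^+ n)).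

Lemma weight_vector_generic chi u (a b : 'I_N -> F) : weight_vector chi u ->
    top_coef u = 0 -> a i0 != 0 -> b i0 != 0 -> a i0 * b i1 - a i1 * b i0 != 0 ->
  pol u (prj (lin a ^+ n)) (prj (lin b ^+ n)) = 0.
Proof.
move=> wu top0 a0 b0 ab.
have i10 : i1 != i0 by apply/eqP => e; move: val_i1; rewrite e val_i0.
(* Rows i0 and i1 of g are a and r, the others those of the identity. As r vanishes at i0 and not at
   i1, g is in the Borel subgroup; its pullback sends x_0 to a and x_0 + x_1 to (a_0/b_0) b. *)
pose r j := a i0 / b i0 * b j - a j.
have r0 : r i0 = 0 by rewrite /r divfK // subrr.
have r1 : r i1 != 0.
  apply: contraNneq ab; rewrite /r => e; apply/eqP; rewrite -[RHS](mulr0 (b i0)) -e.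
  by field.
pose A i j := if i == i0 then a j else if i == i1 then r j else (i == j)%:R.
pose g := mxend A.
have Aupper : upper_triangular g.
  move=> i j ltji; rewrite end_coef_mxend /A.
  have [ei|ni0] := eqVneq i i0; first by move: ltji; rewrite ei val_i0.
  have [ei|ni1] := eqVneq i i1.
    suff -> : j = i0 by []; apply: val_inj => /=.
    by move: ltji; rewrite ei val_i0 val_i1 ltnS leqn0 => /eqP.
  by rewrite -val_eqE /= gtn_eqF.
have ginv : invertible_end g.
  apply: invertible_endP => v gv0.
  have gi i : \sum_(j < N) A i j * crd v j = 0.
    by rewrite -crd_mxend -/g gv0 /crd linear0.
  have vi i : i != i0 -> i != i1 -> crd v i = 0.
    move=> ni0 ni1; have := gi i; rewrite /A (negPf ni0) (negPf ni1) (bigD1 i) //=.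
    rewrite big1 => [|j ji]; first by rewrite eqxx mul1r addr0.
    by rewrite eq_sym (negPf ji) mul0r.
  have v1 : crd v i1 = 0.
    have := gi i1; rewrite /A (negPf i10) eqxx (bigD1 i1) //= big1 => [|j ji].
      by rewrite addr0 => /eqP; rewrite mulf_eq0 (negPf r1) => /eqP.
    have [->|ji0] := eqVneq j i0; first by rewrite r0 mul0r.
    by rewrite vi ?mulr0.
  have v0 : crd v i0 = 0.
    have := gi i0; rewrite /A eqxx (bigD1 i0) //= big1 => [|j ji].
      by rewrite addr0 => /eqP; rewrite mulf_eq0 (negPf a0) => /eqP.
    by have [->|ji1] := eqVneq j i1; rewrite ?v1 ?vi ?mulr0.
  apply: crd_inj => i; rewrite [RHS]/crd linear0.
  have [->//|ni0] := eqVneq i i0; have [->//|ni1] := eqVneq i i1.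
  exact: vi.
have X0 : 'X_i0 = lin (fun j => (j == i0)%:R) :> poly.
  rewrite /lin (bigD1 i0) //= eqxx scale1r big1 ?addr0 // => j ji.
  by rewrite (negPf ji) scale0r.
have X01 : 'X_i0 + 'X_i1 = lin (fun j => (j == i0)%:R + (j == i1)%:R) :> poly.
  rewrite /lin (bigD1 i0) //= eqxx (eq_sym i0) (negPf i10) addr0 scale1r.
  rewrite (bigD1 i1) //= eqxx (negPf i10) add0r scale1r big1 ?addr0 //.
  by move=> j /andP[/negPf -> /negPf ->]; rewrite addr0 scale0r.
have := congr1 (fun w => pol w (prj ('X_i0 ^+ n)) (prj (('X_i0 + 'X_i1) ^+ n)))
  (wu g ginv Aupper).
rewrite pol_sym_act -[RHS]/(pol_at _ _ _) linearZ /= /pol_at -/(top_coef u) top0 mulr0.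
rewrite X01 X0 !pullback_power.
have -> : (fun j => \sum_(i < N) (i == i0)%:R * end_coef g i j) = a.
  apply: funext => j; rewrite (bigD1 i0) //= eqxx mul1r end_coef_mxend /A eqxx.
  by rewrite big1 ?addr0 // => i /negPf ->; rewrite mul0r.
have -> : (fun j => \sum_(i < N) ((i == i0)%:R + (i == i1)%:R) * end_coef g i j) =
    (fun j => a i0 / b i0 * b j).
  apply: funext => j; rewrite (bigD1 i0) //= (bigD1 i1) //= !eqxx (negPf i10).
  rewrite (eq_sym i0) (negPf i10) addr0 add0r !mul1r !end_coef_mxend /A (negPf i10) !eqxx.
  rewrite big1 => [|i /andP[/negPf -> /negPf ->]]; last by rewrite addr0 mul0r.
  by rewrite addr0 /r addrC subrK.
have -> : lin (fun j => a i0 / b i0 * b j) = (a i0 / b i0) *: lin b.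
  by rewrite /lin scaler_sumr; apply: eq_bigr => j _; rewrite scalerA.
rewrite exprZn !linearZ /= => /eqP; rewrite mulf_eq0 expf_eq0 mulf_eq0 invr_eq0.
by rewrite (negPf a0) (negPf b0) andbF => /eqP.
Qed.

Lemma pol_line u (l l' mu mu' : poly) : exists H : {poly F}, forall t,
  H.[t] = pol u (prj ((l + t *: l') ^+ n)) (prj ((mu + t *: mu') ^+ n)).
Proof.
have expand (p p' : poly) t : prj ((p + t *: p') ^+ n) =
    \sum_(x < n.+1) t ^+ x *: prj (p ^+ (n - x) * p' ^+ x *+ 'C(n, x)).
  rewrite exprDn linear_sum; apply: eq_bigr => x _ /=.
  by rewrite exprZn -scalerAr scalerMnr linearZ.
exists (\sum_(x < n.+1) \sum_(y < n.+1)
   pol u (prj (l ^+ (n - x) * l' ^+ x *+ 'C(n, x)))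
         (prj (mu ^+ (n - y) * mu' ^+ y *+ 'C(n, y))) *: 'X^(x + y)) => t.
rewrite !expand pol_sym linear_sum horner_sum; apply: eq_bigr => x _.
rewrite linearZ /= pol_sym linear_sum mulr_sumr horner_sum; apply: eq_bigr => y _.
by rewrite [in RHS]linearZ /= hornerZ hornerXn exprD; ring.
Qed.

(** Density of the open orbit: on the line from (a, b) in direction (x_0, x_0 + x_1) the product H R
    vanishes for all t, and H(0) is the value sought. *)
Lemma weight_vector_eq0 chi u : weight_vector chi u -> top_coef u = 0 -> u = 0.
Proof.
move=> wu top0; apply: beta_eq0 => l mu hl hmu.
have i10 : (i1 == i0) = false by apply/negP => /eqP e; move: val_i1; rewrite e val_i0.
have linE p : p \is 1.-homog -> exists a, p = lin a.
  by move=> hp; have [e <-] := conj_form_surj hp; exists (fun j => (crd e j)^*).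
have [a ->] := linE l hl; have [b ->] := linE mu hmu.
rewrite /beta subn0 subnn !expr0 mulr1 mul1r.
have [H HE] := pol_line u (lin a) 'X_i0 (lin b) ('X_i0 + 'X_i1).
rewrite -[lin a]addr0 -(scale0r 'X_i0) -[lin b]addr0 -(scale0r ('X_i0 + 'X_i1)) -HE.
(* The product of the three genericity conditions along the line; its last factor has leading term
   t^2. *)
pose R := ('X + (a i0)%:P) * ('X + (b i0)%:P) *
  (('X + (a i0)%:P) * ('X + (b i1)%:P) - (a i1)%:P * ('X + (b i0)%:P)).
have X_neq0 c : 'X + c%:P != 0 :> {poly F} by rewrite -size_poly_eq0 size_XaddC.
have R0 : R != 0.
  rewrite !mulf_neq0 //; apply/eqP => /(congr1 (fun p : {poly F} => p`_2)).
  rewrite coef0 coefB coefCM mulrDl coefD coefXM coefCM !coefD !coefX !coefC /=.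
  by rewrite !addr0 !mulr0 addr0 subr0 => /eqP; rewrite oner_eq0.
suff : H * R = 0 by move/eqP; rewrite mulf_eq0 (negPf R0) orbF => /eqP ->; rewrite horner0.
apply: poly_eq0_everywhere => t; rewrite hornerM HE.
have shift (c : 'I_N -> F) (d : 'I_N -> F) :
    lin c + t *: lin d = lin (fun j => c j + t * d j).
  rewrite /lin scaler_sumr -big_split; apply: eq_bigr => j _ /=.
  by rewrite scalerA scalerDl.
have X0 : 'X_i0 = lin (fun j => (j == i0)%:R) :> poly.
  rewrite /lin (bigD1 i0) //= eqxx scale1r big1 ?addr0 // => j ji.
  by rewrite (negPf ji) scale0r.
have X01 : 'X_i0 + 'X_i1 = lin (fun j => (j == i0)%:R + (j == i1)%:R) :> poly.
  rewrite /lin (bigD1 i0) //= eqxx (eq_sym i0) i10 addr0 scale1r.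
  rewrite (bigD1 i1) ?i10 //= eqxx add0r scale1r big1 ?addr0 //.
  by move=> j /andP[/negPf -> /negPf ->]; rewrite addr0 scale0r.
rewrite X01 X0 !shift.
have [Rt0|Rt] := eqVneq R.[t] 0; first by rewrite Rt0 mulr0.
rewrite (weight_vector_generic wu) ?mul0r //.
- by apply: contraNneq Rt; rewrite /R eqxx mulr1 !hornerE addrC => ->; rewrite !mul0r.
- by apply: contraNneq Rt; rewrite /R eqxx (eq_sym i0) i10 addr0 mulr1 !hornerE addrC => ->;
    rewrite mulr0 !mul0r.
apply: contraNneq Rt; rewrite /R !eqxx (eq_sym i0) i10 !addr0 !add0r !mulr0 !mulr1 addr0 !hornerE.
by rewrite [t + a i0]addrC [t + b i0]addrC [t + b i1]addrC => ->; rewrite mulr0.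
Qed.

Lemma highest_weight_vector_unique pi v v' :
    highest_weight_vector rho pi v -> highest_weight_vector rho pi v' ->
  exists c, v = c *: v'.
Proof.
move=> [v0 wv] [v'0 wv'].
have top_v' : top_coef v' != 0 by apply: contraNneq v'0 => /(weight_vector_eq0 wv') ->.
exists (top_coef v / top_coef v'); apply/eqP; rewrite -subr_eq0; apply/eqP.
apply: (@weight_vector_eq0 (fun g => \prod_(i < N) end_coef g i i ^+ nth 0%N pi i)).
  by move=> g ginv gup; rewrite linearB linearZ /= wv // wv' // scalerBr !scalerA mulrC.
rewrite /top_coef -[LHS]/(pol_at _ _ _) linearB linearZ /= /pol_at -!/(top_coef _).
by rewrite divfK // subrr.
Qed.

End HighestWeight.

(** * The decomposition of the ideal *)

Section IdealDecomposition.
Variables (F : numClosedFieldType) (W : vectType F) (n : nat).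
Local Notation N := (\dim {:W}).
Local Notation quads := (hpoly 2 (hpoly n W)).
Local Notation rho := (@sym_act F W 2 n).
Implicit Types (q u : quads) (U : {vspace quads}).

Definition hwspan s : {vspace quads} :=
  projT1 (cid (exists_span (fun ew : W * W => hwform n s ew.1 ew.2))).

Lemma hwform_in s (e w : W) : hwform n s e w \in hwspan s.
Proof.
by have [H _] := projT2 (cid (exists_span (fun ew : W * W => hwform n s ew.1 ew.2)));
  apply: (H (e, w)).
Qed.

Lemma hwspan_sub s U : (forall e w : W, hwform n s e w \in U) -> (hwspan s <= U)%VS.
Proof.
move=> HU.
by have [_ H] := projT2 (cid (exists_span (fun ew : W * W => hwform n s ew.1 ew.2)));
  apply: H => -[e w].
Qed.

Lemma hwspan_ind s U q : (forall e w : W, hwform n s e w \in U) ->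
  q \in hwspan s -> q \in U.
Proof. by move=> /hwspan_sub /subvP; apply. Qed.

Lemma hwspan_padded m s q : (m < s)%N -> q \in hwspan s ->
  vanishing_forms (fun P : hpoly n W => padded m P) q.
Proof.
move=> ltms qs P padP.
have : q \in lker (linfun (eval_at P : quads -> F^o)).
  apply: hwspan_ind qs => e w.
  by rewrite memv_ker lfunE /=; apply/eqP; have H := @hwform_padded F W n m s e w ltms; apply: H.
by rewrite memv_ker lfunE => /eqP.
Qed.

Lemma orth_hwspan s q : (forall e w : W, ip q (hwform n s e w) = 0) ->
  forall u, u \in hwspan s -> ip q u = 0.
Proof.
move=> qs u us; apply: ip_swap0; apply/eqP; rewrite -mem_orthv.
apply: hwspan_ind us => e w.
by rewrite mem_orthv; apply/eqP/ip_swap0.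
Qed.

Lemma hwspan_orth s s' : (s < s')%N -> (s'.*2 <= n)%N ->
  forall u u', u \in hwspan s -> u' \in hwspan s' -> ip u' u = 0.
Proof.
move=> ltss les'n u u' us us'; apply: orth_hwspan us => e w.
by apply: padded_orth; [lia|lia|exact: hwspan_padded us'].
Qed.

Lemma hwspan_stable s : (s.*2 <= n)%N -> GL_stable rho (hwspan s).
Proof.
move=> lesn g _; apply/subvP => _ /memv_imgP [u us ->].
rewrite memv_preim; apply: hwspan_ind us => e w.
by rewrite -memv_preim sym_act_hwform // hwform_in.
Qed.

Lemma hwspan_small s : (0 < s)%N -> (N <= 1)%N -> hwspan s = 0%VS.
Proof.
move=> s_gt0 leN1; apply/eqP; rewrite -subv0; apply: hwspan_sub => e w.
rewrite memv0 hwform_collinear //; have [->|e0] := eqVneq e 0; [by left|right].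
have /eqP -> : <[e]>%VS == {:W}%VS by rewrite eqEdim subvf dim_vline e0.
exact: memvf.
Qed.

(** * Irreducibility of the span of the transvectants of order 2s *)

Section Irreducible.
Variables (i0 i1 : 'I_N) (s : nat).
Hypotheses (val_i0 : i0 = 0%N :> nat) (val_i1 : i1 = 1%N :> nat).
Hypotheses (s_gt0 : (0 < s)%N) (lesn : (s.*2 <= n)%N).
Let b0 := (vbasis {:W})`_i0.
Let b1 := (vbasis {:W})`_i1.
Let v0 := hwform n s b0 b1.
Let pi := [:: 2 * (n - s); 2 * s]%N.

Let i10 : (i1 == i0) = false.
Proof. by apply/negP => /eqP e; move: val_i1; rewrite e val_i0. Qed.

Lemma hwform_orbit (e w : W) : hwform n s e w = 0 \/
  exists2 g : 'End(W), invertible_end g & hwform n s e w = rho g v0.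
Proof.
have [ew|indep] := EM (e = 0 \/ w \in <[e]>%VS).
  by left; apply: hwform_collinear.
have [g ginv [g0 g1]] := exists_end2 val_i0 val_i1 indep.
by right; exists g => //; rewrite /v0 sym_act_hwform // /b0 /b1 g0 g1.
Qed.

Lemma hwform_neq0 : v0 != 0.
Proof.
(* The test point is x_0^(n-s) x_1^s: on b0 + t b1 it equals t^s, so only the term i = s of the
   transvectant survives. *)
apply/eqP => e0; pose m := (U_(i0) *+ (n - s) + U_(i1) *+ s)%MM.
have hm : ('X_[m] : {mpoly F[N]}) \is n.-homog.
  by rewrite dhomogX /= mdegD !mdegMn !mdeg1 !mul1n subnK //; lia.
pose P : hpoly n W := DHomog hm.
have Pt t : ('X_[m] : {mpoly F[N]}).@[crd (1 *: b0 + t *: b1)] = t ^+ s.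
  rewrite /m mpolyXD -!mpolyXn mevalM !rmorphXn /= !mevalXU /b0 /b1.
  rewrite /crd !linearD !linearZ /= -!/(crd _ _) !crd_vbasis !eqxx i10 eq_sym i10.
  by rewrite !mulr1 !mulr0 addr0 add0r expr1n mul1r.
have pc i : (i <= n)%N -> polar_coef n b0 b1 i 'X_[m] *+ 'C(n, i) = n`!%:R *+ (i == s).
  move=> lein.
  pose H := \poly_(k < n.+1)
    (polar_coef n b0 b1 k 'X_[m] *+ 'C(n, k) - n`!%:R *+ (k == s)).
  have H0 : H = 0.
    apply: poly_eq0_everywhere => t; rewrite horner_poly.
    have := eval_lincomb b0 b1 1 t hm; rewrite Pt => /esym/eqP.
    rewrite -subr_eq0 => /eqP {2}<-.
    have lts : (s < n.+1)%N by lia.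
    rewrite (eq_bigr (fun k : 'I_n.+1 => (1 ^+ (n - k) * t ^+ k *+ 'C(n, k)) *
      polar_coef n b0 b1 k 'X_[m] - (n`!%:R *+ (k == s :> nat)) * t ^+ k)); last first.
      by move=> k _; rewrite mulrBl expr1n mul1r !mulrnAl mulrC.
    rewrite sumrB; congr (_ - _); rewrite (bigD1 (Ordinal lts)) //= eqxx mulr1n.
    rewrite big1 ?addr0 // => k ks.
    rewrite (_ : (k == s :> nat) = false) ?mulr0n ?mul0r //.
    by apply: contraNF ks => /eqP e; apply/eqP/val_inj.
  have := congr1 (fun h : {poly F} => h`_i) H0; rewrite coef_poly ltnS lein coef0.
  by move/eqP; rewrite subr_eq0 => /eqP.
have pc0 i : (i <= n)%N -> i != s -> polar_coef n b0 b1 i 'X_[m] = 0.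
  move=> lein nis; have /eqP := pc i lein; rewrite (negPf nis) mulr0n mulrn_eq0.
  by rewrite eqn0Ngt bin_gt0 lein => /eqP.
have pcs : polar_coef n b0 b1 s 'X_[m] != 0.
  have lesn' : (s <= n)%N by lia.
  have := pc s lesn'; rewrite eqxx mulr1n; apply: contra_eqN => /eqP ->.
  by rewrite mul0rn eq_sym pnatr_eq0 eqn0Ngt fact_gt0.
have := heval_hwform b0 b1 P lesn; rewrite -/v0 e0.
have -> : heval (0 : quads) P = 0 by rewrite -[LHS]/(eval_at P 0) linear0.
have lts2 : (s < s.*2.+1)%N by lia.
rewrite (bigD1 (Ordinal lts2)) //= big1 => [|k ks].
  have -> : (s.*2 - s = s)%N by lia.
  move/esym/eqP; rewrite addr0 !mulf_eq0 signr_eq0 pnatr_eq0 (negPf pcs).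
  by rewrite eqn0Ngt bin_gt0 -addnn leq_addr.
have ltk : (k < s.*2.+1)%N := ltn_ord k.
by rewrite pc0 ?mulr0 ?mul0r //; lia.
Qed.

(** g b1 is a multiple of b1 plus a multiple of g b0; the shear removes the latter, and scaling
    gives the weight. *)
Lemma hwform_highest_weight : highest_weight_vector rho pi v0.
Proof.
split; first exact: hwform_neq0.
move=> g ginv gup; rewrite /v0 sym_act_hwform //.
have gb (j : 'I_N) : g (vbasis {:W})`_j = \sum_(i < N) end_coef g i j *: (vbasis {:W})`_i.
  exact: coord_vbasis (memvf _).
have g0 : g b0 = end_coef g i0 i0 *: b0.
  rewrite gb (bigD1 i0) //= big1 ?addr0 // => i ii0.
  rewrite gup ?scale0r // val_i0 lt0n.
  by apply: contraNneq ii0 => e; apply/eqP/val_inj; rewrite /= e val_i0.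
have g1 : g b1 = end_coef g i1 i1 *: b1 + end_coef g i0 i1 *: b0.
  rewrite gb (bigD1 i1) //= (bigD1 i0) ?i10 1?eq_sym ?i10 //= big1 ?addr0 //.
  move=> i /andP[ii1 ii0]; rewrite gup ?scale0r // val_i1 ltn_neqAle lt0n.
  apply/andP; split.
    by apply: contraNneq ii1 => e; apply/eqP/val_inj; rewrite /= -e val_i1.
  by apply: contraNneq ii0 => e; apply/eqP/val_inj; rewrite /= e val_i0.
have a0 : end_coef g i0 i0 != 0.
  apply/eqP => e0; have : b0 \in lker g by rewrite memv_ker g0 e0 scale0r.
  rewrite (eqP ginv) memv0 => /eqP e; have := crd_vbasis i0 i0.
  by rewrite -/b0 e /crd linear0 eqxx => /esym/eqP; rewrite oner_eq0.
rewrite g0 g1 -[end_coef g i0 i1](divfK a0) -scalerA hwform_shear hwform_scale //.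
congr (_ *: _); rewrite (bigD1 i0) //= (bigD1 i1) ?i10 //= val_i0 val_i1 /=.
rewrite big1 ?mulr1 // => i /andP[ii0 ii1].
have i_neq (j : 'I_N) : i != j -> (i : nat) != j by apply: contraNneq => /val_inj ->.
rewrite nth_default ?expr0 //=.
by move: (i_neq _ ii0) (i_neq _ ii1); rewrite val_i0 val_i1; lia.
Qed.

Lemma stable_perp U q : GL_stable rho U -> (forall u, u \in U -> ip q u = 0) ->
  forall g, invertible_end g -> forall u, u \in U -> ip (rho g q) u = 0.
Proof.
move=> stU qU g ginv u uU; have [h hinv gh] := invertible_adjoint ginv.
by rewrite (ip_adjoint _ _ gh) qU // (subvP (stU h hinv)) // memv_img.
Qed.

(** Project v0 orthogonally to U. If the projection is 0, all translates of v0 are orthogonal to U,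
    so U = 0. Otherwise it is a highest weight vector, hence proportional to v0, and U contains all
    translates. *)
Lemma hwspan_irreducible : GL_irreducible rho (hwspan s).
Proof.
split; first exact: hwspan_stable.
  by apply: contraNneq hwform_neq0 => e; rewrite -memv0 -e hwform_in.
move=> U stU leU.
have [v1 [v2 [ev v1U v2U]]] := orth_decomp U v0.
have [v10|v10] := eqVneq v1 0.
  left; apply/eqP; rewrite -subv0; apply/subvP => u uU; rewrite memv0.
  apply/eqP/ip_eq0/(@orth_hwspan s) => [e w|]; last exact: (subvP leU).
  apply: ip_swap0; have [->|[g ginv ->]] := hwform_orbit e w; first exact: ip0l.
  apply: (stable_perp stU) => // u' u'U.
  by rewrite ev v10 add0r v2U.
right; apply/eqP; rewrite eqEsubv leU; apply: hwspan_sub => e w.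
have [_ wv0] := hwform_highest_weight.
have hv1 : highest_weight_vector rho pi v1.
  split=> // g ginv gup; have := wv0 g ginv gup; set c := \prod_(i < _) _.
  rewrite ev linearD scalerDr => ecv.
  (* This difference lies in U and, by [ez], is orthogonal to U. *)
  have zU : rho g v1 - c *: v1 \in U.
    by rewrite rpredB ?rpredZ // (subvP (stU g ginv)) // memv_img.
  apply/eqP; rewrite -subr_eq0; apply/eqP/ip_eq0.
  have ez : rho g v1 - c *: v1 = c *: v2 - rho g v2.
    by apply/eqP; rewrite subr_eq addrAC eq_sym subr_eq addrC -ecv addrC.
  by rewrite {1}ez ipBl ipZl v2U // (stable_perp stU v2U) // mulr0 subrr.
have [c ev0] := highest_weight_vector_unique val_i0 val_i1 hwform_highest_weight hv1.
have v0U : v0 \in U by rewrite ev0 rpredZ.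
have [->|[g ginv ->]] := hwform_orbit e w; first exact: mem0v.
by rewrite (subvP (stU g ginv)) // memv_img.
Qed.

End Irreducible.

(** Two copies share their highest weight line, so their intersection is a nonzero stable subspace
    of both. For dim W <= 1 both are 0, the partition having two positive parts. *)
Lemma hwspan_schur s : (0 < s)%N -> (s.*2 <= n)%N ->
  unique (is_schur_module rho [:: 2 * (n - s); 2 * s]%N) (hwspan s).
Proof.
move=> s_gt0 lesn.
have c2 : count (leq 1) [:: 2 * (n - s); 2 * s]%N = 2%N by rewrite /=; lia.
rewrite /unique /is_schur_module c2; case: ltnP => [ltN|leN]; last first.
  by split=> [|U ->]; rewrite hwspan_small.
pose i0 := Ordinal (ltnW ltN : (0 < N)%N); pose i1 := Ordinal ltN.
have irr := @hwspan_irreducible i0 i1 s erefl erefl s_gt0 lesn.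
have hwv := @hwform_highest_weight i0 i1 s erefl erefl s_gt0 lesn.
split.
  split=> //; exists (hwform n s (vbasis {:W})`_i0 (vbasis {:W})`_i1) => //.
  exact: hwform_in.
move=> U [[stU U0 irrU] [v vU hv]].
have [c ev] := @highest_weight_vector_unique _ _ _ i0 i1 erefl erefl _ _ _ hwv hv.
have [stS S0 irrS] := irr; have [v0n0 _] := hwv.
have vcap : hwform n s (vbasis {:W})`_i0 (vbasis {:W})`_i1 \in (hwspan s :&: U)%VS.
  by rewrite memv_cap hwform_in ev rpredZ.
have stcap : GL_stable rho (hwspan s :&: U)%VS.
  move=> g ginv; apply: subv_trans (limg_cap _ _ _) _.
  by apply: capvS; [exact: stS|exact: stU].
have cap0 : (hwspan s :&: U)%VS <> 0%VS.
  by move=> e; move: vcap; rewrite e memv0 (negPf v0n0).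
have [//|<-] := irrS _ stcap (capvSl _ _).
by have [//|->] := irrU _ stcap (capvSr _ _).
Qed.

Lemma hwspan_directv m K : ((m + K).*2 <= n)%N ->
  directv (\sum_(1 <= k < K.+1) hwspan (m + k))%VS.
Proof.
move=> leK.
have /directvP dimD : directv (\sum_(k < K) hwspan (m + k.+1))%VS.
  apply/directv_sumP => i _; apply/eqP; rewrite -subv0; apply/subvP => x.
  (* An element of one summand that is a sum from the others is orthogonal to itself. *)
  rewrite memv_cap memv0 => /andP[xi /memv_sumP [y yin ex]].
  apply/eqP/ip_eq0; rewrite {1}ex -[LHS]/(ipr x _) linear_sum big1 // => j /= ji.
  have [ltij|ltji|/val_inj eij] := ltngtP i j; last by rewrite eij eqxx in ji.
    have ltjK := ltn_ord j; apply: (hwspan_orth _ _ xi (yin j ji)); lia.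
  have ltiK := ltn_ord i.
  by apply: ip_swap0; apply: (hwspan_orth _ _ (yin j ji) xi); lia.
by rewrite directvE /= !big_add1 /= !big_mkord dimD.
Qed.

Lemma ideal_hwspan m : (m < n)%N -> forall q : quads,
  vanishing_forms (fun P : hpoly n W => padded m P) q <->
  q \in (\sum_(1 <= k < (n./2 - m).+1) hwspan (m + k))%VS.
Proof.
move=> ltmn; rewrite big_add1 /= big_mkord.
have sum_van q : q \in (\sum_(k < n./2 - m) hwspan (m + k.+1))%VS ->
    vanishing_forms (fun P : hpoly n W => padded m P) q.
  move=> /memv_sumP [y yin ->] P padP; rewrite -[LHS]/(eval_at P _) linear_sum.
  rewrite big1 // => k _; have ltm : (m < m + k.+1)%N by rewrite addnS ltnS leq_addr.
  exact: (hwspan_padded ltm (yin k isT) padP).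
move=> q; split=> [vq|]; last exact: sum_van.
(* q2 is in the ideal, as q and q1 are, and orthogonal to all transvectants of order above 2m. *)
have [q1 [q2 [eq q1S q2S]]] := orth_decomp (\sum_(k < n./2 - m) hwspan (m + k.+1))%VS q.
suff q20 : q2 = 0 by rewrite eq q20 addr0.
apply: (padded_orth_eq0 ltmn) => [P padP|s e w ltms lesn].
  have -> : q2 = q - q1 by rewrite eq addrC addKr.
  rewrite -[LHS]/(eval_at P _) linearB /= /eval_at vq // sub0r.
  by rewrite sum_van // oppr0.
apply: q2S; have lts : (s - m.+1 < n./2 - m)%N by lia.
apply: subvP (sumv_sup (Ordinal lts) isT (subvv _)) _ _ => /=.
have -> : (m + (s - m.+1).+1 = s)%N by lia.
exact: hwform_in.
Qed.

End IdealDecomposition.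

Theorem proposition1p6 (R : realType) (W : vectType R[i]) (n m : nat)
    (m_gt0 : (0 < m)%N) (lt_mn : (m < n)%N) :
  ((4 * m < n)%N ->
     cut_out_in_degree 2 (fun P : hpoly n W => padded m P)) /\
  exists U : nat -> {vspace hpoly 2 (hpoly n W)},
    [/\ forall k, (1 <= k <= n./2 - m)%N ->
          unique (is_schur_module (@sym_act R[i] W 2 n)
                    [:: 2 * (n - m - k); 2 * (m + k)]%N) (U k),
        directv (\sum_(1 <= k < (n./2 - m).+1) U k)%VS &
        forall q : hpoly 2 (hpoly n W),
          vanishing_forms (fun P : hpoly n W => padded m P) q <->
          q \in (\sum_(1 <= k < (n./2 - m).+1) U k)%VS].
Proof.
split; first exact: padded_cut_out_by_quadrics.
exists (fun k => hwspan W n (m + k)); split.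
- move=> k /andP[k_gt0 lek]; rewrite -subnDA.
  by apply: hwspan_schur; lia.
(* For n./2 <= m the sum is empty; 2m may then exceed n, so this case is separate. *)
- have [le|lt] := leqP n./2 m.
    move/eqP: le => ->; by rewrite directvE /= !big_geq // dimv0.
  have leK : ((m + (n./2 - m)).*2 <= n)%N.
    by rewrite subnKC ?(ltnW lt) // -[X in (_ <= X)%N](odd_double_half n) leq_addl.
  exact: (hwspan_directv W leK).
exact: ideal_hwspan.
Qed.
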